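(* Let $K$ be a field, $S=K[x_1,\ldots,x_n]$ a standard graded polynomial ring, and let $e,d$ be integers with $2\leq e\leq d$. Let $I\subseteq S$ be a monomial ideal all of whose minimal monomial generators have degree between $e$ and $d$ (inclusive). Suppose that $t_a(S/I)<ea$ for some integer $a$ with $2\leq a\leq \operatorname{pd}_S(S/I)$. Then $$t_{a+b}(S/I)\leq t_a(S/I)+\left\lceil\frac{(2d-1)b}{2}\right\rceil$$ for every integer $b\geq 0$ with $a+b\leq \operatorname{pd}_S(S/I)$.
   Context: For a graded quotient $R=S/I$, let $\beta^S_{i,j}(R)=\dim_K \operatorname{Tor}^S_i(R,K)_j$ be its graded Betti numbers and $\operatorname{pd}_S R$ its projective dimension over $S$. For $0\leq i\leq \operatorname{pd}_S R$, the $i$-th maximal shift is $t_i(R)=\max\{j:\beta^S_{i,j}(R)\neq 0\}$ (with $t_0(R)=0$). *)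

(* Defs.v *)
From HB Require Import structures.
From mathcomp Require Import all_boot all_order all_algebra.
From mathcomp Require Import mpoly.

Set Implicit Arguments.
Unset Strict Implicit.
Unset Printing Implicit Defensive.

Import GRing.Theory.
Local Open Scope ring_scope.

Definition ideal_gen (A : comNzRingType) (G : A -> Prop) (p : A) : Prop :=
  exists s : seq (A * A),
    (forall u, u \in s -> G u.2) /\ p = \sum_(u <- s) u.1 * u.2.

Definition monomial_ideal (K : fieldType) (n : nat)
    (I : {mpoly K[n]} -> Prop) : Prop :=
  exists G : 'X_{1..n} -> Prop,
    forall p, I p <-> ideal_gen (fun g => exists2 m, G m & g = 'X_[m]) p.

(* On 'X_{1..n}, (m' <= m)%MM is componentwise, i.e. divisibility of
   monomials. *)
Definition min_monomial_generator (K : fieldType) (n : nat)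
    (I : {mpoly K[n]} -> Prop) (m : 'X_{1..n}) : Prop :=
  I 'X_[m] /\ forall m' : 'X_{1..n}, (m' <= m)%MM -> I 'X_[m'] -> m' = m.

(* Data of a complex of graded free S-modules of finite rank, S = K[x_1..x_n],
     ... -> F_2 -> F_1 -> F_0 -> S / I,
   where F_i has rank [rk i] and its k-th basis element has degree
   [shift i k].  Elements of F_i are row vectors and maps act by right
   multiplication.  The augmentation F_0 -> S / I is given by representatives
   in S of the images of the basis elements. *)
Record graded_free_complex (K : fieldType) (n : nat) := GradedFreeComplex {
  rk : nat -> nat;
  shift : forall i, 'I_(rk i) -> nat;
  diff : forall i, 'M[{mpoly K[n]}]_(rk i.+1, rk i);
  aug : 'cV[{mpoly K[n]}]_(rk 0)
}.

Record graded_free_resolution (K : fieldType) (n : nat)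
    (I : {mpoly K[n]} -> Prop) (F : graded_free_complex K n) : Prop := {
  diff_homog : forall i (k : 'I_(rk F i.+1)) (l : 'I_(rk F i)),
    forall m, m \in msupp (diff F i k l) ->
      shift k = (mdeg m + shift l)%N;
  aug_homog : forall k : 'I_(rk F 0),
    forall m, m \in msupp (aug F k 0) -> mdeg m = shift k;
  diff_exact : forall i (v : 'rV[{mpoly K[n]}]_(rk F i.+1)),
    v *m diff F i = 0 <-> exists w, v = w *m diff F i.+1;
  aug_exact : forall v : 'rV[{mpoly K[n]}]_(rk F 0),
    I ((v *m aug F) 0 0) <-> exists w, v = w *m diff F 0;
  aug_surj : forall p, exists v : 'rV[{mpoly K[n]}]_(rk F 0),
    I (p - (v *m aug F) 0 0)
}.

(* Tor^S_i(S/I, K)_j is H_i(F (x)_S K)_j for a graded free resolution F of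
   S/I.  Since K = S/(x_1,...,x_n), the i-th term of F (x)_S K is K^(rk i),
   and its differential consists of the constant terms of that of F. *)
Definition diffK (K : fieldType) (n : nat)
    (F : graded_free_complex K n) (i : nat) : 'M[K]_(rk F i.+1, rk F i) :=
  map_mx (mcoeff 0%MM) (diff F i).

(* Its row space is the degree j component of F_i (x)_S K. *)
Definition degree_part (K : fieldType) (n : nat)
    (F : graded_free_complex K n) (i j : nat) : 'M[K]_(rk F i) :=
  \matrix_(k, l) ((k == l) && (shift k == j))%:R.

Definition cycles (K : fieldType) (n : nat)
    (F : graded_free_complex K n) (i j : nat) : 'M[K]_(rk F i) :=
  match i return 'M[K]_(rk F i) with
  | 0 => degree_part F 0 j
  | i'.+1 => (degree_part F i'.+1 j :&: kermx (diffK F i'))%MS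
  end.

Definition boundaries (K : fieldType) (n : nat)
    (F : graded_free_complex K n) (i j : nat) : 'M[K]_(rk F i.+1, rk F i) :=
  degree_part F i.+1 j *m diffK F i.

(* [cycles :\: boundaries] is a complement of the boundaries in the cycles, so
   its rank is the dimension of the homology. *)
Definition betti (K : fieldType) (n : nat)
    (F : graded_free_complex K n) (i j : nat) : nat :=
  \rank (cycles F i j :\: boundaries F i j)%MS.

Definition is_max_shift (K : fieldType) (n : nat)
    (F : graded_free_complex K n) (i t : nat) : Prop :=
  betti F i t <> 0 /\ forall j, betti F i j <> 0 -> (j <= t)%N.

Definition projective (A : nzRingType) (P : lmodType A) : Prop :=
  forall (M N : lmodType A) (g : {linear M -> N}) (f : {linear P -> N}),
    (forall y, exists x, g x = y) ->
    exists h : {linear P -> M}, forall x, g (h x) = f x.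

(* A projective resolution ... -> P_1 -> P_0 -> A / I with P_i = 0 for i > p.
   The augmentation is given by a lift [eps] of it to A, which exists because
   P_0 is projective. *)
Definition projective_resolution_length (A : comNzRingType) (I : A -> Prop)
    (p : nat) : Prop :=
  exists (P : nat -> lmodType A) (d : forall i, {linear P i.+1 -> P i})
         (eps : {linear P 0 -> A^o}),
    [/\ forall i, projective (P i),
        forall i, (p < i)%N -> forall x : P i, x = 0,
        forall i (x : P i.+1), d i x = 0 <-> exists y, x = d i.+1 y,
        forall x : P 0, I (eps x) <-> exists y, x = d 0 y
      & forall q : A, exists x : P 0, I (q - eps x)].

(* p is the projective dimension of A / I over A. *)
Definition is_pd (A : comNzRingType) (I : A -> Prop) (p : nat) : Prop :=
  projective_resolution_length I p /\
  forall q, projective_resolution_length I q -> (p <= q)%N.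

(* Main.v *)
(* Proof idea. Write u_1, ..., u_N for the minimal monomial generators of I. The
   multigraded Betti number of S/I in homological degree i and multidegree m is
   the cohomology of a strand of Taylor's complex: cochains on subsets of
   {1, ..., N} whose lcm is m.  Let f be a cocycle of degree i in multidegree m
   which is not a coboundary, and let u, v be generators dividing m.
   Contracting f with u gives a cochain with coboundary f, so some p | m with
   lcm (p, u) = m has nonzero Betti number in degree i - 1.  Contracting f with
   both u and v shows that either some p | m with lcm (p, u, v) = m has nonzero
   Betti number in degree i - 2, or some p | m with lcm (p, u) = lcm (p, v) = m,
   hence m | p gcd (u, v), has nonzero Betti number in degree i - 1.  If u and
   v are distinct and not coprime, then deg (lcm (u, v)) <= 2 d - 1 and
   deg (gcd (u, v)) <= d - 1, so two steps cost at most 2 d - 1, or one step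
   costs at most d - 1.  If the generators dividing m are pairwise coprime, then
   descending to degree a reaches a product of a generators, of degree at least
   e a, which is excluded by t_a < e a. *)
From HB Require Import structures.
Require Import Defs.
From mathcomp Require Import all_boot all_order all_algebra.
From mathcomp Require Import mpoly.
From mathcomp Require Import zify.
From Stdlib Require Import Classical.

Set Implicit Arguments.
Unset Strict Implicit.
Unset Printing Implicit Defensive.

Import GRing.Theory.
Local Open Scope ring_scope.

(** * Exterior and interior multiplication on functions of subsets *)

Section ExteriorOperators.
Variables (R : comNzRingType) (N : nat).
Implicit Types (x y : 'I_N) (A B V : {set 'I_N}) (f g : {ffun {set 'I_N} -> R}).

(** The factor at [y = x] is 1, so the sign is the same whether or not [x] lies in [A]; [wedge x]
    and its transpose [contr x] can share it. *)
Definition sg x A : R := \prod_(y in A) (if (y < x)%N then -1 else 1).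

Definition wedge x f : {ffun {set 'I_N} -> R} :=
  [ffun A : {set 'I_N} => if x \in A then sg x A * f (A :\ x) else 0].

Definition contr x f : {ffun {set 'I_N} -> R} :=
  [ffun A : {set 'I_N} => if x \in A then 0 else sg x A * f (x |: A)].

Lemma wedge_is_zmod_morphism x : zmod_morphism (wedge x).
Proof.
move=> f g; apply/ffunP => A; rewrite !ffunE.
by case: ifP => _; rewrite ?subr0 // mulrBr.
Qed.
HB.instance Definition _ x :=
  GRing.isZmodMorphism.Build _ _ (wedge x) (wedge_is_zmod_morphism x).

Lemma contr_is_zmod_morphism x : zmod_morphism (contr x).
Proof.
move=> f g; apply/ffunP => A; rewrite !ffunE.
by case: ifP => _; rewrite ?subr0 // mulrBr.
Qed.
HB.instance Definition _ x :=
  GRing.isZmodMorphism.Build _ _ (contr x) (contr_is_zmod_morphism x).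

Lemma sgU1 x y A : y \notin A ->
  sg x (y |: A) = (if (y < x)%N then -1 else 1) * sg x A.
Proof. by move=> yA; rewrite /sg big_setU1. Qed.

Lemma sgD1 x y A : y \in A ->
  sg x (A :\ y) = (if (y < x)%N then -1 else 1) * sg x A.
Proof.
move=> yA; rewrite /sg [in RHS](big_setD1 y) //= mulrA.
by case: ifP => _; rewrite ?mulr1 ?mulrNN ?mul1r.
Qed.

Lemma sgK x A : sg x A * sg x A = 1.
Proof.
rewrite /sg -big_split /= big1 // => y _.
by case: ifP; rewrite ?mulrNN mulr1.
Qed.

Lemma wedgeA x y f : wedge x (wedge y f) = - wedge y (wedge x f).
Proof.
apply/ffunP => A; rewrite !ffunE.
case: (eqVneq x y) => [->|xy].
  by rewrite !inE eqxx /= mulr0; case: ifP; rewrite oppr0.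
rewrite !inE xy (eq_sym y) xy /=.
case xA: (x \in A); case yA: (y \in A); rewrite ?mulr0 ?oppr0 //.
rewrite !sgD1 // setDDl setUC -setDDl.
have [h|h|/val_inj h] := ltngtP x y; last by rewrite h eqxx in xy.
  by rewrite !(mulN1r, mul1r, mulNr, mulrN, opprK) mulrCA.
by rewrite !(mulN1r, mul1r, mulNr, mulrN, opprK) mulrCA.
Qed.

Lemma contrA x y f : contr x (contr y f) = - contr y (contr x f).
Proof.
apply/ffunP => A; rewrite !ffunE.
case: (eqVneq x y) => [->|xy].
  by rewrite !inE eqxx /= mulr0; case: ifP; rewrite oppr0.
rewrite !inE (negbTE xy) (eq_sym y) (negbTE xy) /=.
case xA: (x \in A); case yA: (y \in A); rewrite ?mulr0 ?oppr0 //.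
rewrite !sgU1 ?xA ?yA // !setUA (setUC [set y]).
have [h|h|/val_inj h] := ltngtP x y; last by rewrite h eqxx in xy.
  by rewrite !(mulN1r, mul1r, mulNr, mulrN, opprK) mulrCA.
by rewrite !(mulN1r, mul1r, mulNr, mulrN, opprK) mulrCA.
Qed.

Lemma wedge_wedge x f : wedge x (wedge x f) = 0.
Proof. by apply/ffunP => A; rewrite !ffunE !inE eqxx /= mulr0; case: ifP. Qed.

Lemma contr_contr x f : contr x (contr x f) = 0.
Proof. by apply/ffunP => A; rewrite !ffunE !inE eqxx /= mulr0; case: ifP. Qed.

(** The Clifford relation, source of all contracting homotopies below. For [x = y] one summand
    survives at each [A] and its sign squares to 1; for [x != y] the two summands differ by one
    sign. *)
Lemma wedge_contr x y f :
  wedge x (contr y f) + contr y (wedge x f) = if x == y then f else 0.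
Proof.
case: (eqVneq x y) => [<-|xy]; apply/ffunP => A; rewrite !ffunE !inE ?eqxx /=.
  case xA: (x \in A); rewrite ?addr0 ?add0r.
    by rewrite setD1K // sgD1 // ltnn mul1r mulrA sgK mul1r.
  by rewrite setU1K ?xA // sgU1 ?xA // ltnn mul1r mulrA sgK mul1r.
rewrite (negbTE xy) (eq_sym y) (negbTE xy) /=.
case xA: (x \in A); case yA: (y \in A); rewrite ?mulr0 ?addr0 //.
rewrite sgU1 ?yA // sgD1 ?xA //.
have -> : (y |: A) :\ x = y |: (A :\ x).
  by rewrite setDUl; congr (_ :|: _); apply/setDidPl; rewrite disjoints1 inE eq_sym.
have [h|h|/val_inj h] := ltngtP x y; last by rewrite h eqxx in xy.
  by rewrite !(mulN1r, mul1r, mulNr, mulrN) mulrCA addrC ?addNr ?addrN.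
by rewrite !(mulN1r, mul1r, mulNr, mulrN) mulrCA ?addNr ?addrN.
Qed.

(** The simplicial coboundary that only adds vertices of [V]; [contrs] is the boundary of the full
    simplex. *)
Definition wedges V f := \sum_(x in V) wedge x f.
Definition contrs f := \sum_x contr x f.

Lemma wedges_is_zmod_morphism V : zmod_morphism (wedges V).
Proof.
move=> f g; rewrite /wedges -sumrB.
by apply: eq_bigr => x _; rewrite raddfB.
Qed.
HB.instance Definition _ V :=
  GRing.isZmodMorphism.Build _ _ (wedges V) (wedges_is_zmod_morphism V).

Lemma contrs_is_zmod_morphism : zmod_morphism contrs.
Proof.
move=> f g; rewrite /contrs -sumrB.
by apply: eq_bigr => x _; rewrite raddfB.
Qed.
HB.instance Definition _ :=
  GRing.isZmodMorphism.Build _ _ contrs contrs_is_zmod_morphism.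

(** The terms with [x < y] cancel those with [y < x], and the diagonal vanishes by hypothesis;
    nothing is divided by 2, so characteristic 2 is covered. *)
Lemma big_alternating (M : zmodType) V (F : 'I_N -> 'I_N -> M) :
  (forall x, F x x = 0) -> (forall x y, F x y = - F y x) ->
  \sum_(x in V) \sum_(y in V) F x y = 0.
Proof.
move=> F0 FN.
pose G b := \sum_(x in V) \sum_(y in V | (x < y)%N == b) F x y.
have -> : \sum_(x in V) \sum_(y in V) F x y = G true + G false.
  rewrite -big_split; apply: eq_bigr => x _ /=.
  rewrite (bigID (fun y : 'I_N => (x < y)%N)) /=; congr (_ + _).
    by apply: eq_bigl => y; rewrite eqb_id.
  by apply: eq_bigl => y; rewrite eqbF_neg.
suff -> : G false = - G true by rewrite addrN.
rewrite /G (exchange_big_dep (fun x => x \in V)) /=; last by move=> ? ? ? /andP[].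
rewrite -sumrN; apply: eq_bigr => x xV.
rewrite -sumrN (bigID (fun y => y == x)) /= big1 ?add0r; last first.
  by move=> y /andP[_ /eqP->].
rewrite big_mkcond [RHS]big_mkcond; apply: eq_bigr => y _.
rewrite xV eqb_id /= eqbF_neg -leqNgt ltn_neqAle.
have -> : (x != y :> nat) = (y != x) by rewrite eq_sym.
by case: (y \in V); case: (y != x); case: (x <= y)%N => //=; rewrite ?oppr0 ?FN.
Qed.

Lemma wedges_wedges V f : wedges V (wedges V f) = 0.
Proof.
rewrite /wedges; under eq_bigr do rewrite raddf_sum.
by apply: big_alternating => *; [exact: wedge_wedge|exact: wedgeA].
Qed.

Lemma contrs_contrs f : contrs (contrs f) = 0.
Proof.
have setTE g : contrs g = \sum_(x in setT) contr x g.
  by apply: eq_bigl => x; rewrite inE.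
rewrite !setTE; under eq_bigr do rewrite raddf_sum.
by apply: big_alternating => *; [exact: contr_contr|exact: contrA].
Qed.

(** [contr x] is a contracting homotopy for [wedges V]: on a cocycle [f], it yields a primitive of
    [f]. *)
Lemma wedges_contr V x f : x \in V ->
  wedges V (contr x f) = f - contr x (wedges V f).
Proof.
move=> xV; apply/eqP; rewrite -subr_eq opprK; apply/eqP.
rewrite /wedges raddf_sum -big_split /= (eq_bigr (fun y => if y == x then f else 0)).
  by rewrite -big_mkcondr /= (bigD1 x) ?xV ?eqxx //= big1 ?addr0 // => y /andP[/andP[_ ->]].
by move=> y _; rewrite wedge_contr.
Qed.

Lemma contrs_wedge x f : contrs (wedge x f) = f - wedge x (contrs f).
Proof.
apply/eqP; rewrite -subr_eq opprK; apply/eqP.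
rewrite /contrs raddf_sum -big_split /= (eq_bigr (fun y => if y == x then f else 0)).
  by rewrite -big_mkcond /= big_pred1_eq.
by move=> y _; rewrite addrC wedge_contr eq_sym.
Qed.

Lemma wedgesE V f A :
  wedges V f A = \sum_(x in V :&: A) sg x A * f (A :\ x).
Proof.
rewrite sum_ffunE big_mkcond [RHS]big_mkcond; apply: eq_bigr => x _.
by rewrite ffunE in_setI; case: (x \in V); case: (x \in A).
Qed.

Lemma contrsE f B :
  contrs f B = \sum_(x | x \notin B) sg x B * f (x |: B).
Proof.
rewrite sum_ffunE [RHS]big_mkcond; apply: eq_bigr => x _.
by rewrite ffunE; case: (x \in B).
Qed.

Lemma wedges_neq0 V f A : wedges V f A <> 0 ->
  exists2 x, (x \in V) && (x \in A) & f (A :\ x) <> 0.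
Proof.
move=> h; apply: NNPP => nex; apply: h; rewrite wedgesE big1 // => x.
rewrite in_setI => xVA; suff -> : f (A :\ x) = 0 by rewrite mulr0.
by apply: NNPP => h; apply: nex; exists x.
Qed.

Lemma wedges_sub V f A : A \subset V -> wedges V f A = wedges setT f A.
Proof. by move=> /setIidPr AV; rewrite !wedgesE AV setTI. Qed.

End ExteriorOperators.

(** * Multigraded strands of the dual Taylor complex and descent of nonzero Tor *)

Section TaylorStrands.
Variables (K : fieldType) (n N : nat) (u : 'I_N -> 'X_{1..n}).
Implicit Types (x y : 'I_N) (A B : {set 'I_N}) (m p q : 'X_{1..n}).
Implicit Types (f g : {ffun {set 'I_N} -> K}).

Definition lcms A : 'X_{1..n} := [multinom \max_(x in A) u x k | k < n].

Lemma lcms_lepP A m : reflect (forall x, x \in A -> (u x <= m)%MM) (lcms A <= m)%MM.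
Proof.
apply: (iffP mnm_lepP) => [h x xA|h k].
  by apply/mnm_lepP => k; apply: leq_trans (h k); rewrite mnmE (bigD1 x xA) leq_maxl.
by rewrite mnmE; apply/bigmax_leqP => x /h/mnm_lepP.
Qed.

Lemma lepm_lcms x A : x \in A -> (u x <= lcms A)%MM.
Proof. by move: x; apply/lcms_lepP; apply: lepm_refl. Qed.

Lemma lcms_sub A B : A \subset B -> (lcms A <= lcms B)%MM.
Proof. by move=> AB; apply/lcms_lepP => x /(subsetP AB)/lepm_lcms. Qed.

Lemma lcmsU1 x A : lcms (x |: A) = mlcm (u x) (lcms A).
Proof.
apply/mnmP => k; rewrite !mnmE.
apply/anti_leq/andP; split.
  apply/bigmax_leqP => y; rewrite !inE => /orP[/eqP->|yA]; first exact: leq_maxl.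
  by rewrite leq_max (bigD1 y yA) leq_maxl orbT.
rewrite geq_max; apply/andP; split; first by rewrite (bigD1 x) ?setU11 // leq_maxl.
apply/bigmax_leqP => y yA; rewrite (bigD1 y) ?leq_maxl //.
by rewrite !inE yA orbT.
Qed.

Lemma lcms0 : lcms set0 = 0%MM.
Proof. by apply/mnmP => k; rewrite !mnmE big_set0. Qed.

Lemma mdeg_lem p q : (p <= q)%MM -> (mdeg p <= mdeg q)%N.
Proof. by move=> /mnm_lepP h; rewrite !mdegE leq_sum. Qed.

Lemma lem_mdeg_eq p q : (p <= q)%MM -> (mdeg q <= mdeg p)%N -> p = q.
Proof.
move=> pq; rewrite -{1}(submK pq) mdegD -{2}[mdeg p]add0n leq_add2r leqn0 mdeg_eq0.
by move=> /eqP h; rewrite -(submK pq) h add0m.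
Qed.

Definition supported (i : nat) (P : pred 'X_{1..n}) f :=
  forall A : {set 'I_N}, f A <> 0 -> #|A| = i /\ P (lcms A).

(* [tor i m] says that Tor_i(S/I, K) is nonzero in multidegree m: the degree m
   strand of Taylor's complex tensored with K, dualized, has a cocycle f which
   is not a coboundary. *)
Definition tor (i : nat) m := exists f : {ffun {set 'I_N} -> K},
  [/\ supported i (pred1 m) f,
      forall A : {set 'I_N}, lcms A = m -> wedges setT f A = 0
    & forall g : {ffun {set 'I_N} -> K},
        (forall A : {set 'I_N}, g A <> 0 -> #|A|.+1 = i /\ lcms A = m) ->
        ~ (forall A : {set 'I_N}, lcms A = m -> f A = wedges setT g A)].

Lemma tor_set i m : tor i m -> exists2 A : {set 'I_N}, #|A| = i & lcms A = m.
Proof.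
case=> f [fim _ nb]; apply: NNPP => nex.
have f0 (A : {set 'I_N}) : f A = 0 by apply: NNPP => /fim[Ai /eqP Am]; apply: nex; exists A.
apply: (nb 0) => [A|A _]; first by rewrite ffunE.
by rewrite f0 raddf0 ffunE.
Qed.

Definition below m : {set 'I_N} := [set x | u x <= m]%MM.

Lemma sub_below A m : (A \subset below m) = (lcms A <= m)%MM.
Proof.
apply/subsetP/lcms_lepP => h x /h; first by rewrite inE.
by move=> ?; rewrite inE.
Qed.

Definition upset m (P : pred 'X_{1..n}) :=
  forall p q, (p <= q)%MM -> (q <= m)%MM -> P p -> P q.

Lemma supported_wedges i m P f : upset m P ->
  (forall A : {set 'I_N}, f A <> 0 -> #|A|.+1 = i /\ (P (lcms A) && (lcms A <= m)%MM)) ->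
  supported i (fun q => P q && (q <= m)%MM) (wedges (below m) f).
Proof.
move=> Pup fi A /wedges_neq0[y /andP[yV yA] /fi[Ai /andP[PA Am]]].
have leA : (lcms A <= m)%MM.
  rewrite -sub_below -(setD1K yA) subUset sub1set yV sub_below //.
split; first by rewrite -Ai (cardsD1 y) yA.
by rewrite leA andbT (Pup (lcms (A :\ y))) // lcms_sub // subD1set.
Qed.

(* A cochain is pushed up into the upset Q, one minimal degree at a time, by
   subtracting coboundaries. *)
Lemma push_support i m (P Q : pred 'X_{1..n}) f :
  upset m P -> upset m Q ->
  supported i (fun q => P q && (q <= m)%MM) f ->
  (forall A : {set 'I_N}, wedges (below m) f A <> 0 -> Q (lcms A)) ->
  (forall p, (p <= m)%MM -> P p -> ~~ Q p -> ~ tor i p) ->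
  exists2 f', supported i (fun q => [&& P q, Q q & (q <= m)%MM]) f' &
    wedges (below m) f' = wedges (below m) f.
Proof.
move=> Pup Qup; set V := below m => fP fQ notor.
(* The induction measure: faces outside [Q] lying above some support face outside [Q]. Clearing a
   minimal degree [p] removes [A1], and adds no face because the correction lives above [p]. *)
pose bad f := [set A : {set 'I_N} | [exists B : {set 'I_N},
  [&& f B != 0, ~~ Q (lcms B), ~~ Q (lcms A) &
  (lcms B <= lcms A)%MM]]].
have [k] := ubnP #|bad f|; elim: k f fP fQ => // k IH f fP fQ badk.
case: (pickP (fun A : {set 'I_N} => (f A != 0) && ~~ Q (lcms A))) => [A0 A0P|none]; last first.
  exists f => // A fA; have [Ai /andP[PA Am]] := fP A fA; split => //.
  rewrite PA Am andbT; apply: contraT => QA; move: (none A).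
  by rewrite QA andbT => /negbFE/eqP.
case: (@arg_minnP _ A0 (fun A : {set 'I_N} => (f A != 0) && ~~ Q (lcms A))
  (fun A => mdeg (lcms A)) A0P) => {A0P}A1 /andP[fA1 QA1] minA1.
set p := lcms A1 in minA1.
have /fP[A1i /andP[Pp pm]] : f A1 <> 0 by apply/eqP.
have low (A : {set 'I_N}) : (lcms A <= p)%MM -> lcms A <> p -> f A = 0.
  move=> Ap neq; apply: NNPP => /eqP fA; apply: neq; apply: lem_mdeg_eq => //.
  apply: minA1; rewrite fA /=; apply: contra QA1; exact: Qup.
pose f0 : {ffun {set 'I_N} -> K} := [ffun A : {set 'I_N} => if lcms A == p then f A else 0].
have f0E (A : {set 'I_N}) : (lcms A <= p)%MM -> f0 A = f A.
  by move=> Ap; rewrite ffunE; case: eqP => // /(low _ Ap).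
(* By minimality [f0] agrees with [f] on all faces whose lcm divides [p], and the coboundary of [f]
   vanishes in degree [p] because [p] is outside [Q]. So [f0] is a cocycle of the strand, and
   vanishing Tor gives a primitive [g]. *)
have [g gi fg] : exists2 g : {ffun {set 'I_N} -> K},
    (forall A : {set 'I_N}, g A <> 0 -> #|A|.+1 = i /\ lcms A = p) &
    forall A : {set 'I_N}, lcms A = p -> f0 A = wedges setT g A.
  apply: NNPP => nex; apply: (notor p pm Pp QA1); exists f0; split.
  - by move=> A; rewrite ffunE; case: eqP => // /eqP Ap /fP[].
  - move=> A Ap; transitivity (wedges V f A); last first.
      by apply: NNPP => /fQ; rewrite Ap (negbTE QA1).
    rewrite (@wedges_sub _ _ V) ?sub_below ?Ap // !wedgesE.
    apply: eq_bigr => x _; rewrite f0E // -Ap lcms_sub // subD1set //.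
  - by move=> g gi fg; apply: nex; exists g.
have gP : supported i (fun q => P q && (q <= m)%MM) (wedges V g).
  by apply: supported_wedges => // A /gi[Ai ->]; rewrite Pp pm.
have gup (A : {set 'I_N}) : wedges V g A <> 0 -> (p <= lcms A)%MM.
  by move=> /wedges_neq0[x _ /gi[_ <-]]; rewrite lcms_sub // subD1set.
pose f1 := f - wedges V g.
have f1p (A : {set 'I_N}) : lcms A = p -> f1 A = 0.
  move=> Ap; rewrite !ffunE -f0E ?Ap ?lepm_refl // fg //.
  by rewrite (@wedges_sub _ _ V) ?sub_below ?Ap // subrr.
have df1 : wedges V f1 = wedges V f by rewrite raddfB /= wedges_wedges subr0.
rewrite -df1; apply: IH.
- move=> A f1A; case: (eqVneq (wedges V g A) 0) => [g0|/eqP/gP//].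
  by apply: fP; move: f1A; rewrite !ffunE g0 subr0.
- by rewrite df1.
rewrite ltnS in badk; apply: leq_trans badk; apply: proper_card.
apply/properP; split; last first.
  exists A1.
    by rewrite inE; apply/existsP; exists A1; rewrite fA1 QA1 lepm_refl.
  rewrite inE; apply/existsP => -[B /and4P[f1B QB _ Bp]].
  case: (eqVneq (lcms B) p) => [/f1p/eqP|/eqP neq]; first by rewrite (negbTE f1B).
  move: f1B; rewrite !ffunE low // add0r oppr_eq0 => /eqP/gup pB.
  by apply: neq; apply: lem_mdeg_eq => //; apply: mdeg_lem.
apply/subsetP => A; rewrite !inE => /existsP[B /and4P[f1B QB QA BA]].
apply/existsP; case: (eqVneq (f B) 0) => [fB|]; last first.
  by move=> fB; exists B; rewrite fB QB QA.
exists A1; rewrite fA1 QA1 QA /=; apply: lepm_trans BA; apply: gup.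
by move: f1B; rewrite !ffunE fB add0r oppr_eq0 => /eqP.
Qed.

Definition joins m (s : 'X_{1..n}) : pred 'X_{1..n} := fun q => (m <= mlcm q s)%MM.

Lemma joins_upset m s : upset m (joins m s).
Proof.
move=> p q pq _; rewrite /joins => h; apply: lepm_trans h _.
by rewrite lem_mlcm lem_mlcmr (lepm_trans pq) ?lem_mlcml.
Qed.

(* A cocycle f in degree m is a coboundary as soon as it is the coboundary of a
   cochain whose support contains no degree p < m with nonzero Tor. *)
Lemma tor_below i m (P : pred 'X_{1..n}) f g :
  upset m P ->
  supported i.+1 (pred1 m) f ->
  (forall h : {ffun {set 'I_N} -> K},
     (forall A : {set 'I_N}, h A <> 0 -> #|A|.+1 = i.+1 /\ lcms A = m) ->
     ~ (forall A : {set 'I_N}, lcms A = m -> f A = wedges setT h A)) ->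
  supported i (fun q => P q && (q <= m)%MM) g ->
  wedges (below m) g = f ->
  exists2 p, (p <= m)%MM & P p /\ tor i p.
Proof.
move=> Pup fm fnb gP dg; apply: NNPP => nex.
have mup : upset m (pred1 m).
  move=> p q pq qm /eqP pm; apply/eqP; apply: lem_mdeg_eq qm _.
  by rewrite -pm mdeg_lem.
have [||h hP dh] := push_support Pup mup gP.
- by move=> A; rewrite dg => /fm[].
- by move=> p pm Pp _ torp; apply: nex; exists p.
apply: (fnb h) => [A /hP[-> /and3P[_ /eqP]]|A Am] //.
by rewrite -dg -dh (@wedges_sub _ _ (below m)) // sub_below Am lepm_refl.
Qed.

(** Removing [x] from a face loses at most [u x] from its lcm, so the lcm with [s] still reaches [m]
    once [u x] is joined to [s]. *)
Lemma supported_contr i m x s f :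
  supported i.+1 (joins m s) f ->
  (forall A : {set 'I_N}, f A <> 0 -> (lcms A <= m)%MM) ->
  supported i (fun q => joins m (mlcm (u x) s) q && (q <= m)%MM) (contr x f).
Proof.
move=> fm fle A; rewrite ffunE; case: ifP => // xA h.
have f0 : f (x |: A) <> 0 by move=> f0; apply: h; rewrite f0 mulr0.
have [Ai jA] := fm _ f0; have := fle _ f0.
rewrite lcmsU1 lem_mlcm => /andP[_ ->]; rewrite andbT; split.
  by move: Ai; rewrite cardsU1 xA add1n => -[].
move: jA; rewrite /joins lcmsU1 => jA; apply: lepm_trans jA _.
by apply/mnm_lepP => k; rewrite !mnmE; lia.
Qed.

(** Adding to a face of lcm [m] a generator dividing [m] keeps the lcm, so the condition on the
    strand controls every value of [wedges (below m) f]. *)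
Lemma cocycle_wedges i m f : supported i (pred1 m) f ->
  (forall A : {set 'I_N}, lcms A = m -> wedges setT f A = 0) -> wedges (below m) f = 0.
Proof.
move=> fm df; apply/ffunP => A; rewrite [RHS]ffunE; apply: NNPP => h.
have [x /andP[xV xA] /fm[_ /eqP xm]] := wedges_neq0 h; apply: h.
have Am : (lcms A <= m)%MM.
  by rewrite -sub_below -(setD1K xA) subUset sub1set xV sub_below xm lepm_refl.
rewrite wedges_sub ?sub_below //; apply: df; apply: lem_mdeg_eq => //.
by rewrite -xm mdeg_lem // lcms_sub // subD1set.
Qed.

Lemma supported_top i m f : supported i (pred1 m) f ->
  supported i (joins m 0%MM) f /\ (forall A : {set 'I_N}, f A <> 0 -> (lcms A <= m)%MM).
Proof.
move=> fm; split=> A /fm[Ai /eqP->]; last exact: lepm_refl.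
by split=> //; rewrite /joins mlcm0 lepm_refl.
Qed.

(** [contr x f] is a primitive of the cocycle [f], supported in degrees that [u x] completes to
    [m]. *)
Lemma tor_pred i m x : tor i.+1 m -> (u x <= m)%MM ->
  exists2 p, (p <= m)%MM & (m <= mlcm p (u x))%MM /\ tor i p.
Proof.
case=> f [fm df fnb] xm.
have [f1 f2] := supported_top fm; have := supported_contr (x := x) f1 f2; rewrite mlcm0 => gP.
have [|p pm [jp torp]] := tor_below (@joins_upset m (u x)) fm fnb gP; last by exists p.
by rewrite wedges_contr ?inE // (cocycle_wedges fm df) raddf0 subr0.
Qed.

(* The contractions f_x and f_y both have coboundary f, and their difference is
   the coboundary of f_xy. Pushing the support of f_xy up corrects them to a
   common cochain, whose support lies in both of their upsets. *)
Lemma tor_pred2 i m x y : tor i.+2 m -> (u x <= m)%MM -> (u y <= m)%MM ->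
  (exists2 p, (p <= m)%MM & (m <= mlcm p (mlcm (u x) (u y)))%MM /\ tor i p) \/
  (exists2 p, (p <= m)%MM &
     [/\ m <= mlcm p (u x), m <= mlcm p (u y) & tor i.+1 p]%MM).
Proof.
case=> f [fm df fnb] xm ym; apply: NNPP => /not_or_and[none none'].
apply: none'; set V := below m.
have dVf : wedges V f = 0 by apply: cocycle_wedges fm df.
have [f1 f2] := supported_top fm.
have dVc z : (u z <= m)%MM -> wedges V (contr z f) = f.
  by move=> zm; rewrite wedges_contr ?inE // dVf raddf0 subr0.
have cP z : supported i.+1 (fun q => joins m (u z) q && (q <= m)%MM) (contr z f).
  by have := supported_contr (x := z) f1 f2; rewrite mlcm0.
pose P := joins m (mlcm (u x) (u y)).
pose Q q := joins m (u x) q || joins m (u y) q.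
have Qup : upset m Q.
  by move=> p q pq qm /orP[] h; apply/orP; [left|right]; apply: joins_upset h.
have dxy : wedges V (contr x (contr y f)) = contr y f - contr x f.
  by rewrite wedges_contr ?inE // dVc.
have xyP : supported i (fun q => P q && (q <= m)%MM) (contr x (contr y f)).
  by apply: supported_contr => A /cP[? /andP[]].
(* The coboundary of the double contraction is a difference of two primitives of [f], so it lives in
   [Q]; failing the first alternative, the support can be pushed there as well. *)
have [||h hP dh] := push_support (@joins_upset m _) Qup xyP.
- move=> A; rewrite dxy !ffunE => h; apply/orP.
  case: (eqVneq (contr y f A) 0) => [y0|/eqP/cP[_ /andP[-> _]]]; last by right.
  left; have/cP[_ /andP[]//] : contr x f A <> 0.
  by move=> x0; apply: h; move: x0 y0; rewrite !ffunE => -> ->; rewrite subrr.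
- by move=> p pm Pp _ torp; apply: none; exists p.
(* Splitting [h] along the two upsets and moving one coboundary to each side of [dxy] turns both
   primitives into the same cochain [g]. *)
pose hx : {ffun {set 'I_N} -> K} :=
  [ffun A : {set 'I_N} => if joins m (u x) (lcms A) then h A else 0].
pose hy := h - hx.
have hxP (A : {set 'I_N}) : hx A <> 0 ->
    #|A|.+1 = i.+1 /\ joins m (u x) (lcms A) && (lcms A <= m)%MM.
  by rewrite ffunE; case: ifP => // _ /hP[-> /and3P[_ _ ->]].
have hyP (A : {set 'I_N}) : hy A <> 0 ->
    #|A|.+1 = i.+1 /\ joins m (u y) (lcms A) && (lcms A <= m)%MM.
  rewrite !ffunE; case: ifP => jx; rewrite ?subrr // subr0 => /hP[-> /and3P[_]].
  by rewrite /Q jx /= => -> ->.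
pose g := contr x f + wedges V hx.
have gE : g = contr y f - wedges V hy.
  by rewrite /g /hy raddfB /= dh dxy !opprB addrCA [X in _ = _ + X]addrC subrK addrC.
have := @supported_wedges i.+1 m _ hx (@joins_upset m (u x)) hxP.
have := @supported_wedges i.+1 m _ hy (@joins_upset m (u y)) hyP.
rewrite -/V => dhy dhx.
have gx : supported i.+1 (fun q => joins m (u x) q && (q <= m)%MM) g.
  move=> A; rewrite ffunE => h0.
  case: (eqVneq (wedges V hx A) 0) => [y0|/eqP/dhx//]; apply: cP => x0.
  by apply: h0; rewrite x0 y0 addr0.
have gy : supported i.+1 (fun q => joins m (u y) q && (q <= m)%MM) g.
  move=> A; rewrite gE ffunE [X in _ + X]ffunE => h0.
  case: (eqVneq (wedges V hy A) 0) => [y0|/eqP/dhy//]; apply: cP => x0.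
  by apply: h0; rewrite x0 y0 subr0.
have [|||p pm [/andP[]]] := @tor_below i.+1 m
  (fun q => joins m (u x) q && joins m (u y) q) f g _ fm fnb.
- by move=> p q pq qm /andP[a b]; rewrite !(joins_upset pq qm).
- by move=> A gA; have [-> /andP[-> ->]] := gx A gA; have [_ /andP[->]] := gy A gA.
- by rewrite /g raddfD /= dVc // wedges_wedges addr0.
by exists p.
Qed.

End TaylorStrands.

(** * The degree bound for multigraded Tor *)

Section TaylorBound.
Variables (K : fieldType) (n N : nat) (u : 'I_N -> 'X_{1..n}) (e d a : nat).
Implicit Types (m p q : 'X_{1..n}).

Definition mgcm p q : 'X_{1..n} := [multinom minn (p k) (q k) | k < n].

Lemma mdeg_mlcm_mgcm p q : (mdeg (mlcm p q) + mdeg (mgcm p q) = mdeg p + mdeg q)%N.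
Proof.
rewrite !mdegE -!big_split /=; apply: eq_bigr => k _.
by rewrite !mnmE addnC addn_min_max.
Qed.

(** In a variable where [p] falls short of [m], both [q] and [r] reach the exponent of [m], hence so
    does their gcd. *)
Lemma mlcm_mgcm m p q r : (p <= m)%MM -> (m <= mlcm p q)%MM -> (m <= mlcm p r)%MM ->
  (m <= p + mgcm q r)%MM.
Proof.
move=> /mnm_lepP pm /mnm_lepP pq /mnm_lepP pr; apply/mnm_lepP => k.
by move: (pm k) (pq k) (pr k); rewrite !mnmE; lia.
Qed.

(** Each variable divides at most one of the pairwise coprime monomials, so it contributes a single
    term. *)
Lemma mdeg_lcms_coprime (A : {set 'I_N}) :
  (forall x y, x \in A -> y \in A -> x != y -> mgcm (u x) (u y) = 0%MM) ->
  (\sum_(x in A) mdeg (u x) <= mdeg (lcms u A))%N.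
Proof.
move=> cop; rewrite mdegE; under eq_bigr do rewrite mdegE.
rewrite exchange_big /=; apply: leq_sum => k _; rewrite mnmE.
case: (pickP (fun x => (x \in A) && (u x k != 0%N))) => [x /andP[xA uxk]|none].
  rewrite (bigD1 x xA) big1 /= ?addn0; first exact: leq_bigmax_cond.
  move=> y /andP[yA yx]; move: (cop x y xA yA); rewrite eq_sym => /(_ yx)/mnmP/(_ k).
  by rewrite !mnmE; move: uxk; lia.
by rewrite big1 // => x xA; move: (none x); rewrite xA /= => /negbFE/eqP.
Qed.

Hypothesis mdeg_ge : forall x, (e <= mdeg (u x))%N.
Hypothesis mdeg_le : forall x, (mdeg (u x) <= d)%N.
Hypothesis antichain : forall x y, (u x <= u y)%MM -> x = y.

Lemma tor_below_gen i m : tor K u i.+1 m -> exists x, (u x <= m)%MM.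
Proof.
move=> /tor_set[A Ai Am].
have /card_gt0P[x xA] : (0 < #|A|)%N by rewrite Ai.
by exists x; rewrite -Am lepm_lcms.
Qed.

Lemma tor_descend b m : tor K u (a + b) m -> exists2 p, (p <= m)%MM & tor K u a p.
Proof.
elim: b m => [|b IH] m; first by rewrite addn0 => h; exists m; rewrite ?lepm_refl.
rewrite addnS => h; have [x xm] := tor_below_gen h.
have [p pm [_ /IH[q qp tq]]] := tor_pred h xm.
by exists q => //; apply: lepm_trans pm.
Qed.

(** The term [b./2] records one degree saved per two steps. The induction is strong because a round
    descends by one or two homological degrees. *)
Lemma tor_bound : (forall m, tor K u a m -> (mdeg m < e * a)%N) ->
  forall b m, tor K u (a + b) m ->
  exists2 p, tor K u a p & (mdeg m + b./2 <= mdeg p + d * b)%N.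
Proof.
move=> lt_ea; elim/ltn_ind => -[|[|b]] IH m.
- by rewrite addn0 => h; exists m; rewrite // muln0.
- rewrite addn1 => h; have [x xm] := tor_below_gen h.
  have [p pm [/mdeg_lem mp tp]] := tor_pred h xm; exists p => //.
  by have := mdeg_mlcm_mgcm p (u x); have := mdeg_le x; lia.
move=> h; case: (classic (exists x y,
  [/\ u x <= m, u y <= m, x != y & mgcm (u x) (u y) != 0]%MM)) => [|nover]; last first.
  have [q qm tq] := tor_descend h; have [A Aa Aq] := tor_set tq.
  have := lt_ea q tq; rewrite -Aq ltnNge => /negP[].
  apply: leq_trans (mdeg_lcms_coprime _); last first.
    move=> x y xA yA xy; apply/eqP; apply: contraT => g0; exfalso; apply: nover.
    by exists x, y; split=> //; apply: lepm_trans qm; rewrite -Aq lepm_lcms.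
  by rewrite mulnC -Aa -sum_nat_const; apply: leq_sum.
case=> x [y [xm ym xy g0]].
have g1 : (0 < mdeg (mgcm (u x) (u y)))%N by rewrite lt0n mdeg_eq0.
(* By the antichain property the gcd is a proper divisor, so its degree is at most [d - 1]. *)
have g2 : (mdeg (mgcm (u x) (u y)) < mdeg (u x))%N.
  rewrite ltnNge; apply: contra xy => hg; apply/eqP; apply: antichain.
  have gx : (mgcm (u x) (u y) <= u x)%MM by apply/mnm_lepP => k; rewrite !mnmE geq_minl.
  rewrite -(lem_mdeg_eq gx hg); apply/mnm_lepP => k; rewrite !mnmE geq_minr //.
have dx := mdeg_le x; have dy := mdeg_le y.
have gl := mdeg_mlcm_mgcm (u x) (u y).
rewrite !addnS in h; case: (tor_pred2 h xm ym) => -[p pm].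
  case=> /mdeg_lem mp /IH[] // q tq hq; exists q => //.
  by have := mdeg_mlcm_mgcm p (mlcm (u x) (u y)); move: hq; rewrite /=; nia.
(* A single step costing at most [d - 1] pays for the unit by which [b.+2./2] may exceed
   [b.+1./2]. *)
case=> px py; rewrite -addnS => /IH[] // q tq hq; exists q => //.
have := mdeg_lem (mlcm_mgcm pm px py); rewrite mdegD; move: hq => /=; nia.
Qed.

End TaylorBound.

(** * Selecting terms of a polynomial by their monomials *)

Section MonomialFilter.
Variables (K : fieldType) (n : nat).
Implicit Types (P Q : pred 'X_{1..n}) (p q : {mpoly K[n]}).

Definition mfilter P p : {mpoly K[n]} :=
  \sum_(m <- msupp p | P m) p@_m *: 'X_[m].

Lemma mcoeff_filter P p m : (mfilter P p)@_m = if P m then p@_m else 0.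
Proof.
rewrite /mfilter raddf_sum /= -big_filter.
under eq_bigr do rewrite mcoeffZ mcoeffX.
case: ifP => Pm; last first.
  rewrite big1_seq // => k /andP[_]; rewrite mem_filter => /andP[Pk _].
  by case: eqP => [km|_]; [rewrite -km Pk in Pm|rewrite mulr0].
have [mp|mp] := boolP (m \in msupp p).
  rewrite (bigD1_seq m) ?mem_filter ?Pm ?filter_uniq ?msupp_uniq //= eqxx mulr1.
  by rewrite big1 ?addr0 // => k /negbTE->; rewrite mulr0.
rewrite (memN_msupp_eq0 mp) big1_seq // => k /andP[_]; rewrite mem_filter => /andP[_ kp].
by case: eqP => [km|_]; [rewrite -km kp in mp|rewrite mulr0].
Qed.

Lemma mfilter_sum P (J : finType) (F : J -> {mpoly K[n]}) :
  mfilter P (\sum_j F j) = \sum_j mfilter P (F j).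
Proof.
apply/mpolyP => m; rewrite mcoeff_filter !raddf_sum /=.
case: ifP => Pm; last by rewrite big1 // => j _; rewrite mcoeff_filter Pm.
by apply: eq_bigr => j _; rewrite mcoeff_filter Pm.
Qed.

(** The intended case is a homogeneous [q] and a degree condition [P], with [Q] the condition
    shifted by the degree of [q]. *)
Lemma mfilterM P Q p q :
  (forall m1 m2, m2 \in msupp q -> P (m1 + m2)%MM = Q m1) ->
  mfilter P (p * q) = mfilter Q p * q.
Proof.
move=> PQ; apply/mpolyP => m; rewrite mcoeff_filter !mcoeffM.
under [RHS]eq_bigr do rewrite mcoeff_filter.
have PQk m1 m2 : m = (m1 + m2)%MM ->
    (if Q m1 then p@_m1 else 0) * q@_m2 = if P m then p@_m1 * q@_m2 else 0.
  move=> ->; have [q0|q0] := eqVneq q@_m2 0; first by rewrite q0 !mulr0 if_same.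
  by rewrite PQ ?mcoeff_msupp //; case: ifP; rewrite ?mul0r.
rewrite [RHS](eq_bigr (fun k : 'X_{1..n < (mdeg m).+1, (mdeg m).+1} =>
  if P m then p@_k.1 * q@_k.2 else 0)); last first.
  by move=> k /eqP; apply: PQk.
by case: ifP => // _; rewrite big1.
Qed.

End MonomialFilter.

(** * Homogeneous matrices and graded components of row vectors *)

Section GradedMatrices.
Variables (K : fieldType) (n : nat).

Definition homogeneous r1 r2 (s1 : 'I_r1 -> nat) (s2 : 'I_r2 -> nat)
    (M : 'M[{mpoly K[n]}]_(r1, r2)) :=
  forall k l m, m \in msupp (M k l) -> s1 k = (mdeg m + s2 l)%N.

Definition degree_row r (s : 'I_r -> nat) t (v : 'rV[{mpoly K[n]}]_r) :=
  \row_l mfilter (fun m => t == mdeg m + s l)%N (v 0 l).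

Lemma degree_row_mul r1 r2 (s1 : 'I_r1 -> nat) (s2 : 'I_r2 -> nat) t v M :
  homogeneous s1 s2 M ->
  degree_row s2 t (v *m M) = degree_row s1 t v *m M.
Proof.
move=> hM; apply/rowP => l; rewrite !mxE mfilter_sum; apply: eq_bigr => k _.
by rewrite !mxE; apply: mfilterM => m1 m2 /hM->; rewrite mdegD addnA.
Qed.

Lemma degree_row_id r (s : 'I_r -> nat) t (v : 'rV[{mpoly K[n]}]_r) :
  (forall l m, m \in msupp (v 0 l) -> t = (mdeg m + s l)%N) -> degree_row s t v = v.
Proof.
move=> h; apply/rowP => l; rewrite !mxE; apply/mpolyP => m; rewrite mcoeff_filter.
case: ifP => // /negbT hm; apply/esym/memN_msupp_eq0; apply: contra hm => /h{1}->.
by rewrite eqxx.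
Qed.

Lemma msupp_degree_row r (s : 'I_r -> nat) t (v : 'rV[{mpoly K[n]}]_r) l m :
  m \in msupp (degree_row s t v 0 l) -> t = (mdeg m + s l)%N.
Proof. by rewrite mxE mcoeff_msupp mcoeff_filter; case: (t =P _) => // _; rewrite eqxx. Qed.

End GradedMatrices.

Lemma diffmx_rank_eq0 (K : fieldType) p q r (A : 'M[K]_(p, r)) (B : 'M_(q, r)) :
  (\rank (A :\: B)%MS == 0%N) = (A <= B)%MS.
Proof.
rewrite -(eqn_add2l (\rank (A :&: B))%N) mxrank_cap_compl addn0 eq_sym.
rewrite (mxrank_leqif_sup (capmxSl A B)).2 sub_capmx submx_refl //.
Qed.

Lemma row_choice (R : Type) p q (P : 'I_p -> 'rV[R]_q -> Prop) :
  (forall k, exists v, P k v) -> exists M : 'M[R]_(p, q), forall k, P k (row k M).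
Proof.
move=> /fin_all_exists[f fP]; exists (\matrix_k f k) => k.
by rewrite rowK.
Qed.

(** * Comparison of graded free resolutions and invariance of nonzero Betti numbers *)

Section Comparison.
Variables (K : fieldType) (n : nat) (I : {mpoly K[n]} -> Prop).
Local Notation S := {mpoly K[n]}.

Hypothesis I0 : I 0.
Hypothesis ID : forall p q : S, I p -> I q -> I (p + q).
Hypothesis IM : forall p q : S, I q -> I (p * q).
Hypothesis Ifilter : forall (P : pred 'X_{1..n}) p, I p -> I (mfilter P p).

Lemma ideal_mulmx p q (v : 'rV[S]_p) (M : 'M[S]_(p, q)) l :
  (forall k, I (M k l)) -> I ((v *m M) 0 l).
Proof.
move=> h; rewrite mxE; apply: (big_ind I) => // k _; exact: IM.
Qed.

Section Lifts.
Variables F G : graded_free_complex K n.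

(** [M] is the top component of a partial chain map over multiplication by [c] on [S/I], with the
    lower components bound existentially. The value 1 gives comparison maps, the value 0 their
    differences. *)
Fixpoint lifts (c : S) i : 'M[S]_(rk F i, rk G i) -> Prop :=
  match i with
  | 0 => fun M => forall k, I ((M *m aug G - c *: aug F) k 0)
  | i'.+1 => fun M => exists2 M', lifts c M' & M *m diff G i' = diff F i' *m M'
  end.

Hypothesis hF : graded_free_resolution I F.
Hypothesis hG : graded_free_resolution I G.

Lemma lifts_boundary c i (M : 'M_(rk F i, rk G i)) (w : 'rV[S]_(rk F i.+1)) :
  lifts c M -> exists w', w *m diff F i *m M = w' *m diff G i.
Proof.
case: i M w => [|i] M w /= => [hM|[M' hM' eM]].
  apply/(aug_exact hG); rewrite -mulmxA -[M *m _](subrK (c *: aug F)) mulmxDr mxE.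
  apply: ID; first exact: ideal_mulmx.
  rewrite -scalemxAr mxE; apply: IM; apply/(aug_exact hF); by exists w.
apply/(diff_exact hG); rewrite -[LHS]mulmxA eM mulmxA.
have -> : w *m diff F i.+1 *m diff F i = 0 by apply/(diff_exact hF); exists w.
by rewrite mul0mx.
Qed.

(** The comparison theorem; homogeneity is obtained by keeping only the degree [shift k] part of any
    lift of the [k]-th basis vector. *)
Lemma lift_exists i :
  exists2 M, homogeneous (@shift _ _ F i) (@shift _ _ G i) M & lifts 1 M.
Proof.
elim: i => [|i [M hM lM]].
  have /row_choice[M MP] : forall k, exists v : 'rV[S]_(rk G 0),
      (forall l m, m \in msupp (v 0 l) -> shift k = (mdeg m + shift l)%N) /\
      I ((v *m aug G) 0 0 - aug F k 0).
    move=> k; have [v hv] := aug_surj hG (aug F k 0).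
    (* [S] is viewed as free on one generator of degree 0, which makes [aug G] a homogeneous
       matrix. *)
    pose s0 (l : 'I_1) := 0%N.
    exists (degree_row (@shift _ _ G 0) (shift k) v); split.
      by move=> l m; apply: msupp_degree_row.
    have augG : homogeneous (@shift _ _ G 0) s0 (aug G).
      by move=> k' l m; rewrite (ord1 l) addn0 => /(aug_homog hG)->.
    rewrite -(degree_row_mul _ _ augG) mxE -opprB -mulN1r; apply: IM.
    set P := fun m => _; suff -> : aug F k 0 = mfilter P (aug F k 0).
      have -> : mfilter P (aug F k 0) - mfilter P ((v *m aug G) 0 0) =
        mfilter P (aug F k 0 - (v *m aug G) 0 0).
        apply/mpolyP => m; rewrite mcoeffB !mcoeff_filter mcoeffB.
        by case: ifP; rewrite ?subr0.
      exact: Ifilter.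
    apply/mpolyP => m; rewrite mcoeff_filter /P; case: eqP => // h.
    apply: memN_msupp_eq0; apply/negP => /(aug_homog hF) h'; apply: h.
    by rewrite addn0.
  exists M => [k l m|k]; first by have [+ _] := MP k => /(_ l m); rewrite mxE.
  have [_] := MP k; rewrite -row_mul !mxE mul1r //.
have /row_choice[M' MP] : forall k, exists v : 'rV[S]_(rk G i.+1),
    (forall l m, m \in msupp (v 0 l) -> shift k = (mdeg m + shift l)%N) /\
    v *m diff G i = row k (diff F i *m M).
  move=> k; have [v] := lifts_boundary (delta_mx 0 k) lM.
  rewrite -mulmxA -rowE => hv.
  exists (degree_row (@shift _ _ G i.+1) (shift k) v); split.
    by move=> l m; apply: msupp_degree_row.
  have dG : homogeneous (@shift _ _ G i.+1) (@shift _ _ G i) (diff G i).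
    exact: diff_homog hG i.
  rewrite -(degree_row_mul _ _ dG) -hv row_mul (degree_row_mul _ _ hM).
  by rewrite degree_row_id // => l m; rewrite mxE; apply: (diff_homog hF).
exists M' => [k l m|]; first by have [+ _] := MP k => /(_ l m); rewrite mxE.
exists M => //; apply/row_matrixP => k; have [_ <-] := MP k.
by rewrite row_mul.
Qed.

End Lifts.

Lemma lifts_comp F G i (A : 'M_(rk F i, rk G i)) (B : 'M_(rk G i, rk F i)) :
  lifts 1 A -> lifts 1 B -> lifts 0 (A *m B - 1%:M).
Proof.
elim: i A B => [|i IH] A B /= => [hA hB k|[A' lA eA] [B' lB eB]].
  have -> : (A *m B - 1%:M) *m aug F - 0 *: aug F =
      A *m (B *m aug F - 1 *: aug G) + (A *m aug G - 1 *: aug F).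
    by rewrite !scale1r scale0r subr0 mulmxBl mul1mx mulmxBr mulmxA addrA subrK.
  rewrite mxE; apply: ID => //.
  have -> (M : 'cV_(rk G 0)) : (A *m M) k 0 = (row k A *m M) 0 0 by rewrite -row_mul [RHS]mxE.
  exact: ideal_mulmx.
exists (A' *m B' - 1%:M); first exact: IH.
by rewrite mulmxBl mul1mx mulmxBr mulmx1 -mulmxA eB mulmxA eA mulmxA.
Qed.

Section Homotopy.
Variable F : graded_free_complex K n.
Hypothesis hF : graded_free_resolution I F.

Lemma diff_exact_mx p i (M : 'M_(p, rk F i.+1)) : M *m diff F i = 0 ->
  exists H, M = H *m diff F i.+1.
Proof.
move=> M0; have /row_choice[H HP] : forall k, exists v, v *m diff F i.+1 = row k M.
  move=> k; have [|w ->] := (diff_exact hF (row k M)).1; last by exists w.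
  by rewrite -row_mul M0 row0.
by exists H; apply/row_matrixP => k; rewrite -HP row_mul.
Qed.

(** Of the two terms of a null-homotopy of [M], the one through the previous module dies after
    composing with [diff F i]. Stating only what remains gives a uniform form for [i = 0] and
    [i > 0]. *)
Lemma lifts0_boundary i (M : 'M_(rk F i, rk F i)) : lifts 0 M ->
  exists H, diff F i *m M = diff F i *m H *m diff F i.
Proof.
elim: i M => [|i IH] M /= => [hM|[M' /IH[H eH] eM]].
  have /row_choice[H HP] : forall k, exists v, v *m diff F 0 = row k M.
    move=> k; have [|w ->] := (aug_exact hF (row k M)).1; last by exists w.
    by have := hM k; rewrite scale0r subr0 -row_mul [in X in _ -> X]mxE.
  exists H; rewrite -mulmxA; congr (_ *m _).
  by apply/row_matrixP => k; rewrite -HP row_mul.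
have [|H' eH'] := @diff_exact_mx _ _ (M - diff F i *m H).
  by rewrite mulmxBl eM eH subrr.
exists H'; rewrite -mulmxA -eH' mulmxBr mulmxA.
suff -> : diff F i.+1 *m diff F i = 0 by rewrite mul0mx subr0.
apply/row_matrixP => k; rewrite row0 row_mul; apply/(diff_exact hF).
by exists (delta_mx 0 k); rewrite -rowE.
Qed.

Lemma lifts0_homotopy i (M : 'M_(rk F i.+1, rk F i.+1)) : lifts 0 M ->
  exists H H', M = diff F i *m H + H' *m diff F i.+1.
Proof.
case=> M' /lifts0_boundary[H eH] eM; exists H.
have [|H' eH'] := @diff_exact_mx _ _ (M - diff F i *m H).
  by rewrite mulmxBl eM eH subrr.
by exists H'; rewrite -eH' addrC subrK.
Qed.

End Homotopy.

(* A form of [betti F i.+1 t <> 0] which is self-dual and visibly preserved by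
   chain maps: the cocycle c shows that the cycle z is not a boundary. *)
Definition detected_cycle (F : graded_free_complex K n) i t :=
  exists (z : 'rV[K]_(rk F i.+1)) (c : 'cV[K]_(rk F i.+1)),
    [/\ forall l, z 0 l != 0 -> shift l = t,
        z *m diffK F i = 0, diffK F i.+1 *m c = 0 & (z *m c) 0 0 != 0].

Local Notation red := (map_mx (mcoeff 0%MM)).

(** The cycle is pushed along [A] and the cocycle pulled back along [B]. Since [A *m B - 1] is
    null-homotopic, it pairs a cycle with a cocycle to 0, so the value of the pairing is kept. *)
Lemma detected_cycle_transfer F G i t :
  graded_free_resolution I F -> graded_free_resolution I G ->
  detected_cycle F i t -> detected_cycle G i t.
Proof.
move=> hF hG [z [c [zt zF Fc zc]]].
have [A hA lA] := lift_exists hF hG i.+1.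
(* Lifting one position higher provides the commuting square that makes [red B *m c] a cocycle. *)
have [B2 _ [B lB eB]] := lift_exists hG hF i.+2.
have [H [H' eAB]] := lifts0_homotopy hF (lifts_comp lA lB).
have [A' _ eA] := lA.
have redM p q r (X : 'M[S]_(p, q)) (Y : 'M[S]_(q, r)) : red (X *m Y) = red X *m red Y.
  exact: map_mxM.
exists (z *m red A), (red B *m c); split.
- move=> l; rewrite mxE => h.
  have [k /andP[zk Akl]] : exists k, (z 0 k != 0) && ((A k l)@_0 != 0).
    apply/existsP; apply: contraR h => /existsPn h; rewrite big1 // => k _.
    by move: (h k); rewrite mxE negb_and !negbK => /orP[]/eqP->; rewrite ?mul0r ?mulr0.
  by rewrite -(zt k zk) (hA k l 0%MM) ?mcoeff_msupp // mdeg0.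
- by rewrite -mulmxA /diffK -redM eA redM mulmxA -/(diffK F i) zF mul0mx.
- by rewrite mulmxA /diffK -redM -eB redM -mulmxA -/(diffK F i.+1) Fc mulmx0.
rewrite mulmxA -[z *m _ *m _]mulmxA -redM -[A *m B](subrK 1%:M) eAB.
rewrite !raddfD /= ?redM map_mx1 -/(diffK F i) -/(diffK F i.+1).
rewrite mulmx1 mulmxA zF mul0mx add0r mulmxDl !mulmxA.
by rewrite -[z *m _ *m _ *m c]mulmxA Fc mulmx0 add0r.
Qed.

Section Betti.
Variable F : graded_free_complex K n.
Hypothesis hF : graded_free_resolution I F.

Lemma mulmx_degree_part p i t (M : 'M[K]_(p, rk F i)) k l :
  (M *m degree_part F i t) k l = if shift l == t then M k l else 0.
Proof.
rewrite mxE (bigD1 l) //= big1 => [|j jl]; rewrite mxE.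
  by rewrite eqxx addr0; case: ifP; rewrite ?mulr1 ?mulr0.
by rewrite (negbTE jl) mulr0.
Qed.

Lemma degree_part_mulmx p i t (M : 'M[K]_(rk F i, p)) k l :
  (degree_part F i t *m M) k l = if shift k == t then M k l else 0.
Proof.
rewrite mxE (bigD1 k) //= big1 => [|j jl]; rewrite mxE.
  by rewrite eqxx addr0; case: ifP; rewrite ?mul1r ?mul0r.
by rewrite eq_sym (negbTE jl) mul0r.
Qed.

(** A nonzero constant term in a homogeneous matrix joins basis elements of equal degree. *)
Lemma diffK_degree i t :
  diffK F i *m degree_part F i t = degree_part F i.+1 t *m diffK F i.
Proof.
apply/matrixP => k l; rewrite mulmx_degree_part degree_part_mulmx.
have [h|h] := eqVneq (diffK F i k l) 0; first by rewrite h !if_same.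
suff -> : shift k = shift l by [].
by move: h; rewrite mxE -mcoeff_msupp => /(diff_homog hF)->; rewrite mdeg0.
Qed.

(** A cycle that is not a boundary is separated from the boundaries by a column of their cokernel
    matrix; its degree [t] part is the cocycle. *)
Lemma betti_detected_cycle i t : betti F i.+1 t <> 0%N <-> detected_cycle F i t.
Proof.
have -> : betti F i.+1 t <> 0%N <-> ~~ (cycles F i.+1 t <= boundaries F i.+1 t)%MS.
  by rewrite /betti -diffmx_rank_eq0; split=> /eqP.
split=> [/row_subPn[k]|[z [c [zt zF Fc zc]]]].
  set z := row k _ => zB.
  have : (z <= cycles F i.+1 t)%MS by exact: row_sub.
  rewrite /= sub_capmx => /andP[zt /sub_kermxP zF].
  have zE : z *m degree_part F i.+1 t = z.
    have /submxP[w ->] := zt; apply/matrixP => a b.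
    by rewrite !mulmx_degree_part; case: (shift b == t).
  have : z *m cokermx (boundaries F i.+1 t) != 0 by rewrite -submxE.
  case/matrix0Pn => a [b]; rewrite (ord1 a) => zc.
  exists z, (degree_part F i.+1 t *m col b (cokermx (boundaries F i.+1 t))).
  split=> [l|||] //.
  - by rewrite -zE mulmx_degree_part; case: (shift l =P t) => //; rewrite eqxx.
  - rewrite mulmxA diffK_degree -/(boundaries F i.+1 t) colE mulmxA mulmx_coker.
    by rewrite mul0mx.
  - by rewrite mulmxA zE colE mulmxA -colE mxE.
have zE : z *m degree_part F i.+1 t = z.
  apply/rowP => l; rewrite mulmx_degree_part; case: eqP => // h.
  by apply/esym/eqP; apply: contraT => /zt.
apply: contra zc => cb.
have /submxP[w ->] : (z <= boundaries F i.+1 t)%MS.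
  apply: submx_trans cb; rewrite /= sub_capmx; apply/andP; split; last exact/sub_kermxP.
  by rewrite -zE submxMl.
by rewrite /boundaries -!mulmxA Fc !mulmx0 mxE.
Qed.

End Betti.

End Comparison.

(** * Exactness of Taylor's complex, one multidegree at a time *)

Section Dehomogenization.
Variables (K : fieldType) (n N : nat) (u : 'I_N -> 'X_{1..n}).
Implicit Types (x y : 'I_N) (A B : {set 'I_N}) (m : 'X_{1..n}).
Implicit Types (f g : {ffun {set 'I_N} -> {mpoly K[n]}}) (h : {ffun {set 'I_N} -> K}).
Local Notation lcms := (lcms u).

Lemma mcoeffXM (p : {mpoly K[n]}) m k :
  ('X_[m] * p)@_k = if (m <= k)%MM then p@_(k - m) else 0.
Proof.
rewrite mulrC; case: ifP => [mk|/negbT mk]; first by rewrite -{1}(submK mk) addmC mcoeffMX.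
apply: memN_msupp_eq0; apply: contra mk => /msuppM_le/allpairsP[[m1 m2] /= [_ + ->]].
by rewrite msuppX inE => /eqP->; rewrite lem_addl.
Qed.

(** Taylor's boundary in all homological degrees at once, [f A] being the coefficient of the basis
    element of [A]. *)
Definition taylor_diff f : {ffun {set 'I_N} -> {mpoly K[n]}} :=
  [ffun B : {set 'I_N} => \sum_(x | x \notin B)
     sg K x B *: ('X_[lcms (x |: B) - lcms B] * f (x |: B))].

(* The strand of total multidegree m of Taylor's complex, with the monomial
   coefficients x^(m - lcms A) set to 1. *)
Definition dehom m f : {ffun {set 'I_N} -> K} :=
  [ffun A : {set 'I_N} => if (lcms A <= m)%MM then (f A)@_(m - lcms A) else 0].

Definition rehom m h : {ffun {set 'I_N} -> {mpoly K[n]}} :=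
  [ffun A : {set 'I_N} => h A *: 'X_[m - lcms A]].

Lemma dehom_inj f g : (forall m, dehom m f = dehom m g) -> f = g.
Proof.
move=> fg; apply/ffunP => A; apply/mpolyP => k.
by have /ffunP/(_ A) := fg (k + lcms A)%MM; rewrite !ffunE lem_addl addmK.
Qed.

Lemma dehom0 m : dehom m 0 = 0.
Proof. by apply/ffunP => A; rewrite !ffunE mcoeff0 if_same. Qed.

Lemma dehomD m f g : dehom m (f + g) = dehom m f + dehom m g.
Proof. by apply/ffunP => A; rewrite !ffunE mcoeffD; case: ifP; rewrite ?addr0. Qed.

(** Within a strand the monomial weights are forced by the multidegree, so setting them to 1 leaves
    the plain simplicial boundary. *)
Lemma dehom_taylor_diff m f : dehom m (taylor_diff f) = contrs (dehom m f).
Proof.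
apply/ffunP => B; rewrite contrsE !ffunE.
have [Bm|Bm] := boolP (lcms B <= m)%MM; last first.
  rewrite big1 // => x _; rewrite ffunE; case: ifP => [xBm|_]; last by rewrite mulr0.
  by case/negP: Bm; apply: lepm_trans xBm; rewrite lcms_sub ?subsetUr.
rewrite raddf_sum; apply: eq_bigr => x xB; rewrite /= mcoeffZ mcoeffXM ffunE.
have BxB : (lcms B <= lcms (x |: B))%MM by rewrite lcms_sub ?subsetUr.
have -> : (lcms (x |: B) - lcms B <= m - lcms B)%MM = (lcms (x |: B) <= m)%MM.
  move: BxB Bm => /mnm_lepP BxB /mnm_lepP Bm.
  by apply/mnm_lepP/mnm_lepP => le k; move: (le k) (BxB k) (Bm k); rewrite ?mnmBE; lia.
case: ifP => // xBm; congr (_ * _@__); apply/mnmP => k; rewrite !mnmBE.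
by move: BxB xBm => /mnm_lepP/(_ k) + /mnm_lepP/(_ k); lia.
Qed.

Lemma taylor_diffK f : taylor_diff (taylor_diff f) = 0.
Proof.
by apply: dehom_inj => m; rewrite !dehom_taylor_diff contrs_contrs dehom0.
Qed.

Lemma dehom_rehom m k h : (forall A : {set 'I_N}, h A <> 0 -> (lcms A <= k)%MM) ->
  dehom m (rehom k h) = if m == k then h else 0.
Proof.
move=> hk; apply/ffunP => A; rewrite !ffunE mcoeffZ mcoeffX.
have [h0|/eqP/hk Ak] := eqVneq (h A) 0.
  by rewrite h0 mul0r if_same; case: ifP; rewrite ?h0 ?ffunE.
case: (eqVneq m k) => [->|mk]; first by rewrite Ak eqxx mulr1.
rewrite ffunE; case: ifP => // Am; case: eqP; rewrite ?mulr0 // => km.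
by case/eqP: mk; rewrite -(submK Ak) km submK.
Qed.

Lemma dehom_sum_rehom m (s : seq 'X_{1..n}) (h : 'X_{1..n} -> {ffun {set 'I_N} -> K}) :
  uniq s -> (forall k (A : {set 'I_N}), h k A <> 0 -> (lcms A <= k)%MM) ->
  dehom m (\sum_(k <- s) rehom k (h k)) = if m \in s then h m else 0.
Proof.
move=> us hk; rewrite (big_morph _ (dehomD m) (dehom0 m)).
under eq_bigr => k _ do rewrite (dehom_rehom _ (hk k)).
case: ifP => ms; last first.
  by rewrite big1_seq // => k /= ks; case: eqP => // mk; rewrite mk ks in ms.
rewrite (bigD1_seq m) //= eqxx big1 ?addr0 // => k km.
by rewrite eq_sym (negbTE km).
Qed.

Lemma dehom_finite f : exists2 s : seq 'X_{1..n}, uniq s &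
  forall m, m \notin s -> dehom m f = 0.
Proof.
exists (undup (flatten [seq [seq (k + lcms A)%MM | k <- msupp (f A)] |
                          A <- enum {: {set 'I_N}}])); first exact: undup_uniq.
move=> m; rewrite mem_undup => ms; apply/ffunP => A; rewrite !ffunE.
case: ifP => // Am; apply: memN_msupp_eq0; apply: contra ms => kf.
apply/flattenP; exists [seq (k + lcms A)%MM | k <- msupp (f A)].
  by apply/mapP; exists A; rewrite ?mem_enum.
by apply/mapP; exists (m - lcms A)%MM => //; rewrite submK.
Qed.

(* In multidegree m, wedging with a generator dividing m is a contracting
   homotopy. *)
Lemma taylor_diff_exact f : taylor_diff f = 0 ->
  (forall m, dehom m f <> 0 -> exists x, (u x <= m)%MM) ->
  exists g, f = taylor_diff g.
Proof.
move=> df fu; have [s us sf] := dehom_finite f.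
(* The default 0 is harmless: by hypothesis the strand of [f] vanishes when no generator divides
   [m]. *)
pose h m := if [pick x | (u x <= m)%MM] is Some y then wedge y (dehom m f) else 0.
exists (\sum_(m <- s) rehom m (h m)); apply: dehom_inj => m.
rewrite dehom_taylor_diff dehom_sum_rehom //; last first.
  move=> k A; rewrite /h; case: pickP => [y yk|_]; last by rewrite ffunE.
  rewrite !ffunE; case: ifP => // yA hA.
  rewrite -(setD1K yA) lcmsU1 lem_mlcm yk /=.
  by apply: contra_notT hA => /negbTE->; rewrite mulr0.
case: ifP => [_|/negbT/sf->]; last by rewrite raddf0.
rewrite /h; case: pickP => [y ym|none].
  by rewrite contrs_wedge -dehom_taylor_diff df dehom0 raddf0 subr0.
rewrite raddf0; apply: NNPP => /fu[x].
by rewrite none.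
Qed.

End Dehomogenization.

(** * The Taylor resolution and its Betti numbers *)

Section TaylorComplex.
Variables (K : fieldType) (n N : nat) (u : 'I_N -> 'X_{1..n}).
Implicit Types (x y : 'I_N) (A B : {set 'I_N}) (m : 'X_{1..n}).
Local Notation S := {mpoly K[n]}.
Local Notation lcms := (lcms u).

Definition taylor_rk i := #|[set A : {set 'I_N} | #|A| == i]|.
Definition face i (k : 'I_(taylor_rk i)) : {set 'I_N} := enum_val k.

(** At most one [x] contributes to each matrix entry; the sum avoids having to choose it. *)
Definition taylor : graded_free_complex K n :=
  @GradedFreeComplex K n taylor_rk (fun i k => mdeg (lcms (face k)))
    (fun i => \matrix_(k, l) \sum_(x in face k)
       if face l == face k :\ x
       then sg K x (face k) *: 'X_[lcms (face k) - lcms (face l)] else 0)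
    (const_mx 1).

Lemma card_face i (k : 'I_(taylor_rk i)) : #|face k| = i.
Proof. by have := enum_valP k; rewrite inE => /eqP. Qed.

Lemma sum_face (M : zmodType) i (F : {set 'I_N} -> M) :
  \sum_(k < taylor_rk i) F (face k) = \sum_(A : {set 'I_N} | #|A| == i) F A.
Proof.
rewrite [RHS](eq_bigl (fun A => A \in [set A : {set 'I_N} | #|A| == i])); last first.
  by move=> A; rewrite inE.
by rewrite [RHS]big_enum_val.
Qed.

Lemma sum_face_eq (M : zmodType) i (F : {set 'I_N} -> M) A : #|A| = i ->
  \sum_(k < taylor_rk i) (if face k == A then F (face k) else 0) = F A.
Proof.
move=> Ai; rewrite (sum_face _ (fun B => if B == A then F B else 0)).
rewrite (bigD1 A) ?Ai ?eqxx //= big1 ?addr0 // => B /andP[_ /negbTE->] //.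
Qed.

Definition extend (R : zmodType) i (v : 'I_(taylor_rk i) -> R) : {ffun {set 'I_N} -> R} :=
  [ffun A : {set 'I_N} => \sum_k if face k == A then v k else 0].

Lemma extendE (R : zmodType) i (v : 'I_(taylor_rk i) -> R) k : extend v (face k) = v k.
Proof.
rewrite ffunE (bigD1 k) //= eqxx big1 ?addr0 // => l lk.
by rewrite (inj_eq enum_val_inj) (negbTE lk).
Qed.

Lemma card_extend (R : zmodType) i (v : 'I_(taylor_rk i) -> R) A :
  extend v A <> 0 -> #|A| = i.
Proof.
rewrite ffunE => h; apply: NNPP => Ai; apply: h; rewrite big1 // => k _.
by case: eqP => // kA; case: Ai; rewrite -kA card_face.
Qed.

Lemma face_exists i A : #|A| = i -> exists k : 'I_(taylor_rk i), face k = A.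
Proof.
move=> Ai; have AS : A \in [set A : {set 'I_N} | #|A| == i] by rewrite inE Ai.
by exists (enum_rank_in AS A); rewrite /face enum_rankK_in.
Qed.

Lemma setU1_D1 x A B : (x \in A) && (B == A :\ x) = (x \notin B) && (A == x |: B).
Proof.
apply/andP/andP => -[h /eqP->]; first by rewrite !inE eqxx setD1K.
by rewrite setU11 setU1K.
Qed.

Lemma mul_taylor_diff i (f : {ffun {set 'I_N} -> S}) l :
  ((\row_k f (face k)) *m diff taylor i) 0 l = taylor_diff u f (face l).
Proof.
rewrite !mxE ffunE; under eq_bigr do rewrite !mxE big_mkcond mulr_sumr.
rewrite exchange_big [RHS]big_mkcond /=; apply: eq_bigr => x _; set B := face l.
pose F A := if x \notin B then sg K x B *: ('X_[lcms A - lcms B] * f A) else 0.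
have eF k : f (face k) * (if x \in face k then if B == face k :\ x then
    sg K x (face k) *: 'X_[lcms (face k) - lcms B] else 0 else 0) =
    if face k == x |: B then F (face k) else 0.
  have := setU1_D1 x (face k) B; rewrite /F; case: (x \in face k) => /=.
    move=> ->; case: (boolP (x \in B)) => xB; rewrite ?mulr0 ?if_same //=.
    case: eqP => [->|]; rewrite ?mulr0 //.
    by rewrite sgU1 // ltnn mul1r -scalerAr mulrC.
  by rewrite mulr0; case: (x \in B) => /= [_|<-]; rewrite ?if_same.
under eq_bigr do rewrite eF; case: (boolP (x \in B)) => xB.
  by rewrite big1 // => k _; rewrite /F xB if_same.
by rewrite (sum_face_eq F) ?cardsU1 ?xB ?card_face // /F xB.
Qed.

Lemma row_extend (R : zmodType) i (v : 'rV[R]_(taylor_rk i)) :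
  v = \row_k extend (v 0) (face k).
Proof. by apply/rowP => k; rewrite mxE extendE. Qed.

Lemma row_aug (f : {ffun {set 'I_N} -> S}) : ((\row_k f (face k)) *m aug taylor) 0 0 = f set0.
Proof.
rewrite mxE; under eq_bigr do rewrite !mxE mulr1.
rewrite sum_face (big_pred1 set0) // => A; exact: cards_eq0.
Qed.

Lemma taylor_diff_extend i (v : 'rV[S]_(taylor_rk i.+1)) : v *m diff taylor i = 0 ->
  taylor_diff u (extend (v 0)) = 0.
Proof.
move=> v0; apply/ffunP => B; rewrite [RHS]ffunE.
case: (eqVneq #|B| i) => [/face_exists[l <-]|Bi].
  by rewrite -mul_taylor_diff -row_extend v0 mxE.
rewrite ffunE big1 // => x xB; suff -> : extend (v 0) (x |: B) = 0 by rewrite mulr0 scaler0.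
by apply: contra_neq_eq Bi => /eqP/card_extend; rewrite cardsU1 xB => -[].
Qed.

(** Exactness reduces to finding a generator that divides each nonzero multidegree: a nonempty face
    supplies one in positive homological degree, membership in [I] in degree 0. *)
Lemma taylor_resolution (I : S -> Prop) : I 0 ->
  (forall p q, I p -> I q -> I (p + q)) -> (forall p q : S, I q -> I (p * q)) ->
  (forall x, I 'X_[u x]) ->
  (forall p m, I p -> m \in msupp p -> exists x, (u x <= m)%MM) ->
  graded_free_resolution I taylor.
Proof.
move=> I0 ID IM Iu Ix; split.
- move=> i k l m; rewrite mxE => /msupp_sum_le/flattenP[_ /mapP[x _ ->]].
  case: eqP => [lk|_]; last by rewrite msupp0.
  move=> /msuppZ_le; rewrite msuppX inE => /eqP->.
  by rewrite /= -mdegD submK // lk lcms_sub // subD1set.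
- move=> k m; rewrite mxE msupp1 inE => /eqP->; rewrite mdeg0 /=.
  by have /eqP := card_face k; rewrite cards_eq0 => /eqP->; rewrite lcms0 mdeg0.
- move=> i v; split=> [v0|[w ->]].
    have [|g fg] := taylor_diff_exact (taylor_diff_extend v0).
      move=> m m0; have [A] : exists A, dehom u m (extend (v 0)) A <> 0.
        by apply: NNPP => h; apply: m0; apply/ffunP => A; rewrite [RHS]ffunE;
          apply: NNPP => h'; apply: h; exists A.
      rewrite ffunE; case: ifP => // Am eA.
      have /card_extend Ai : extend (v 0) A <> 0 by move=> e0; rewrite e0 mcoeff0 in eA.
      have /card_gt0P[x xA] : (0 < #|A|)%N by rewrite Ai.
      by exists x; apply: lepm_trans Am; apply: lepm_lcms.
    exists (\row_k g (face k)); apply/rowP => l.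
    by rewrite mul_taylor_diff -fg extendE.
  rewrite [w]row_extend; set f := extend _.
  have -> : (\row_k f (face k)) *m diff taylor i.+1 = \row_k taylor_diff u f (face k).
    by apply/rowP => l; rewrite mul_taylor_diff mxE.
  by apply/rowP => l; rewrite mul_taylor_diff taylor_diffK !ffunE mxE.
- move=> v; rewrite {1}[v]row_extend row_aug; split=> [Iv|[w ->]].
    have [||g fg] := @taylor_diff_exact _ _ _ u (extend (v 0)).
    + apply/ffunP => B; rewrite !ffunE big1 // => x xB.
      suff -> : extend (v 0) (x |: B) = 0 by rewrite mulr0 scaler0.
      by apply: NNPP => /card_extend; rewrite cardsU1 xB.
    + move=> m m0; have [A] : exists A, dehom u m (extend (v 0)) A <> 0.
        by apply: NNPP => h; apply: m0; apply/ffunP => A; rewrite [RHS]ffunE;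
          apply: NNPP => h'; apply: h; exists A.
      rewrite ffunE; case: ifP => // Am eA.
      have /card_extend/eqP : extend (v 0) A <> 0 by move=> e0; rewrite e0 mcoeff0 in eA.
      rewrite cards_eq0 => /eqP A0; apply: (Ix _ m Iv).
      by rewrite mcoeff_msupp; move: eA; rewrite A0 lcms0 subm0 => /eqP.
    exists (\row_k g (face k)); apply/rowP => l.
    by rewrite mul_taylor_diff -fg extendE.
  have [k <-] := @face_exists 0 set0 (cards0 _).
  rewrite extendE {1}[w]row_extend mul_taylor_diff ffunE.
  apply: (big_ind I) => // x _; rewrite -mul_mpolyC; apply: (IM).
  have /eqP := card_face k; rewrite cards_eq0 => /eqP->.
  rewrite setU0 lcms0 subm0 mulrC.
  have -> : lcms [set x] = u x by apply/mnmP => j; rewrite mnmE big_set1.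
  exact: IM.
- move=> p; exists (\row_k [ffun _ => p] (face k)).
  by rewrite row_aug ffunE subrr.
Qed.

Lemma diffK_taylor i k l : diffK taylor i k l = \sum_(x in face k)
  if (face l == face k :\ x) && (lcms (face k :\ x) == lcms (face k))
  then sg K x (face k) else 0.
Proof.
rewrite !mxE raddf_sum; apply: eq_bigr => x _ /=.
case: eqP => [->|_]; last by rewrite mcoeff0.
rewrite mcoeffZ mcoeffX /=.
have le : (lcms (face k :\ x) <= lcms (face k))%MM by rewrite lcms_sub // subD1set.
have -> : (lcms (face k) - lcms (face k :\ x) == 0)%MM = (lcms (face k :\ x) == lcms (face k)).
  apply/eqP/eqP => [h|->]; last by apply/mnmP => j; rewrite mnmBE mnm0E subnn.
  by rewrite -[RHS](submK le) h add0m.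
by case: ifP; rewrite ?mulr1 ?mulr0.
Qed.

Lemma diffK_taylor_mul i (f : {ffun {set 'I_N} -> K}) k :
  (diffK taylor i *m \col_l f (face l)) k 0 =
  \sum_(x in face k | lcms (face k :\ x) == lcms (face k)) sg K x (face k) * f (face k :\ x).
Proof.
rewrite mxE; under eq_bigr do rewrite diffK_taylor mxE mulr_suml.
rewrite exchange_big /= [RHS]big_mkcondr /=; apply: eq_bigr => x xk.
case: ifP => hx; last by rewrite big1 // => l _; rewrite andbF mul0r.
rewrite -(@sum_face_eq _ i (fun A => sg K x (face k) * f A) (face k :\ x)); last first.
  by have := cardsD1 x (face k); rewrite xk card_face => -[].
by apply: eq_bigr => l _; rewrite andbT; case: ifP; rewrite ?mul0r.
Qed.

Lemma diffK_taylor_strand i m (f : {ffun {set 'I_N} -> K}) k :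
  (forall A : {set 'I_N}, f A <> 0 -> lcms A = m) ->
  (diffK taylor i *m \col_l f (face l)) k 0 =
  if lcms (face k) == m then wedges setT f (face k) else 0.
Proof.
move=> fm; rewrite diffK_taylor_mul wedgesE setTI.
case: eqP => [km|km].
  rewrite [RHS](bigID (fun x => lcms (face k :\ x) == m)) /=.
  rewrite [X in _ = _ + X]big1 ?addr0 ?km // => x /andP[_ h].
  by rewrite (_ : f _ = 0) ?mulr0 //; apply: NNPP => /fm/eqP; apply/negP.
rewrite big1 // => x /andP[_ /eqP h].
by rewrite (_ : f _ = 0) ?mulr0 //; apply: NNPP => /fm h'; apply: km; rewrite -h.
Qed.

(** Encodes the lcm of a face in a finite type, so that faces can be grouped by multidegree. *)
Lemma below_lcms A B : (below u (lcms A) == below u (lcms B)) = (lcms A == lcms B).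
Proof.
apply/eqP/eqP => [h|->//].
have key C D : below u (lcms C) = below u (lcms D) -> (lcms C <= lcms D)%MM.
  by move=> e; rewrite -sub_below -e sub_below lepm_refl.
by apply: lem_mdeg_eq (key _ _ h) (mdeg_lem (key _ _ (esym h))).
Qed.

(** The reduced differential preserves multidegree, so a nonzero pairing of cycle and cocycle is
    already nonzero in one multidegree; conversely linear duality separates a nontrivial class from
    the coboundaries. *)
Lemma tor_detected_cycle i t :
  detected_cycle taylor i t <-> exists2 m, mdeg m = t & tor K u i.+1 m.
Proof.
split=> [[z [c [zt zF Fc zc]]]|[m mt [f [fm df fnb]]]].
  have [k0 k0P] : exists k0 : 'I_(taylor_rk i.+1),
      \sum_(k < taylor_rk i.+1 | lcms (face k) == lcms (face k0)) z 0 k * c k 0 != 0.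
    apply/existsP; apply: contraR zc => /existsPn h; rewrite mxE.
    rewrite (partition_big (fun k => below u (lcms (face k))) predT) //= big1 // => J _.
    case: (pickP (fun k : 'I_(taylor_rk i.+1) => below u (lcms (face k)) == J)) =>
      [k0 /eqP<-|none].
      by under eq_bigl do rewrite below_lcms; apply/eqP; move: (h k0); rewrite negbK.
    by rewrite big_pred0.
  set m := lcms (face k0) in k0P.
  exists m.
    have [k /andP[/eqP km zk]] : exists k, (lcms (face k) == m) && (z 0 k != 0).
      apply/existsP; apply: contraR k0P => /existsPn h; rewrite big1 // => k km.
      by move: (h k); rewrite km /= negbK => /eqP->; rewrite mul0r.
    by rewrite -(zt k zk) /= km.
  pose f : {ffun {set 'I_N} -> K} :=
    [ffun A : {set 'I_N} => if lcms A == m then extend (c^~ 0) A else 0].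
  exists f; split.
  - move=> A; rewrite ffunE; case: ifP => // Am /card_extend->.
    by [].
  - move=> A Am; rewrite wedgesE setTI.
    case: (eqVneq #|A| i.+2) => [/face_exists[k kA]|Ai]; last first.
      rewrite big1 // => x xA; rewrite ffunE; case: ifP => _; last by rewrite mulr0.
      rewrite (_ : extend _ _ = 0) ?mulr0 //; apply: contra_neq_eq Ai => /eqP/card_extend.
      by rewrite (cardsD1 x A) xA => ->.
    have := diffK_taylor_mul (extend (c^~ 0)) k.
    have -> : \col_l extend (c^~ 0) (face l) = c by apply/colP => l; rewrite mxE extendE.
    rewrite Fc mxE kA big_mkcondr /= => e; rewrite [RHS]e; apply: eq_bigr => x xA.
    by rewrite ffunE Am; case: ifP; rewrite ?mulr0.
  (* If [g] were a primitive of [f], the pairing in multidegree [m] would be that of [g] with the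
     boundary of the cycle [z], which is 0. *)
  move=> g gm fg; case/eqP: k0P.
  have gm' A : g A <> 0 -> lcms A = m by case/gm.
  have : z *m (diffK taylor i *m \col_l g (face l)) = 0 by rewrite mulmxA zF mul0mx.
  move=> /matrixP/(_ 0 0); rewrite mxE [in X in _ = X -> _]mxE => e.
  rewrite -[RHS]e [LHS]big_mkcond; apply: eq_bigr => k _.
  rewrite (diffK_taylor_strand _ gm'); case: ifP => [/eqP km|_]; last by rewrite mulr0.
  by rewrite -fg // ffunE km eqxx extendE.
have fm' A : f A <> 0 -> lcms A = m by case/fm => _ /eqP.
pose c := \col_l f (face (i := i.+1) l).
(* A preimage of [c], restricted to multidegree [m], would be a primitive of [f]. *)
have cD : ~~ (c^T <= (diffK taylor i)^T)%MS.
  apply/negP => /submxP[w /(congr1 trmx)]; rewrite trmx_mul !trmxK => e.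
  pose g : {ffun {set 'I_N} -> K} :=
    [ffun A : {set 'I_N} => if lcms A == m then extend (w 0) A else 0].
  have gm A : g A <> 0 -> #|A|.+1 = i.+1 /\ lcms A = m.
    by rewrite ffunE; case: eqP => // Am /card_extend->.
  apply: (fnb g gm) => A Am; case: (eqVneq #|A| i.+1) => [/face_exists[k kA]|Ai]; last first.
    transitivity (0 : K).
      by apply: contra_neq_eq Ai => /eqP/fm[].
    apply/esym; apply: contra_neq_eq Ai => /eqP/wedges_neq0[x /andP[_ xA] /gm[+ _]].
    by rewrite (cardsD1 x A) xA.
  have := congr1 (fun M : 'cV_(taylor_rk i.+1) => M k 0) e; rewrite mxE kA => ->.
  have -> : w^T = \col_l extend (w 0) (face l) by apply/colP => l; rewrite !mxE extendE.
  rewrite diffK_taylor_mul kA wedgesE setTI big_mkcondr /=; apply: eq_bigr => x xA.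
  by rewrite [in RHS]ffunE Am; case: ifP; rewrite ?mulr0.
have : c^T *m cokermx (diffK taylor i)^T != 0 by rewrite -submxE.
case/matrix0Pn => a [b]; rewrite (ord1 a) => zc.
pose z0 := (col b (cokermx (diffK taylor i)^T))^T.
have z0D : z0 *m diffK taylor i = 0.
  apply: trmx_inj; rewrite trmx_mul trmx0 trmxK colE mulmxA mulmx_coker.
  by rewrite mul0mx.
(* Cutting [z0] down to multidegree [m] makes it homogeneous and keeps its pairing with [c], which
   is supported there. *)
pose z : 'rV[K]_(taylor_rk i.+1) := \row_k if lcms (face k) == m then z0 0 k else 0.
exists z, c; split.
- by move=> k; rewrite mxE; case: (lcms (face k) =P m) => [km _|_]; rewrite ?eqxx //= km.
- apply/rowP => l; rewrite [RHS]mxE.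
  transitivity (if lcms (face l) == m then (z0 *m diffK taylor i) 0 l else 0); last first.
    by rewrite z0D mxE if_same.
  rewrite mxE; have DE k : diffK taylor i k l != 0 -> lcms (face k) = lcms (face l).
    rewrite diffK_taylor => h; apply: NNPP => kl; case/eqP: h; rewrite big1 // => x _.
    by case: ifP => // /andP[/eqP lk /eqP h]; case: kl; rewrite lk h.
  transitivity (\sum_k if lcms (face l) == m then z0 0 k * diffK taylor i k l else 0).
    apply: eq_bigr => k _; have [d0|/DE kl] := eqVneq (diffK taylor i k l) 0.
      by rewrite d0 !mulr0 if_same.
    by rewrite mxE kl; case: ifP; rewrite ?mul0r.
  by case: ifP => _; [rewrite mxE|rewrite big1].
- apply/colP => k; rewrite (diffK_taylor_strand _ fm') mxE.
  by case: eqP => // /df->.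
suff -> : (z *m c) 0 0 = (c^T *m cokermx (diffK taylor i)^T) 0 b by [].
rewrite !mxE; apply: eq_bigr => k _; rewrite !mxE mulrC.
case: eqP => // km; rewrite (_ : f (face k) = 0) ?mul0r //.
by apply: NNPP => /fm'.
Qed.

End TaylorComplex.

(** * Monomial ideals and their finitely many minimal generators *)

Section MonomialIdeals.
Variables (K : fieldType) (n : nat) (I : {mpoly K[n]} -> Prop).
Local Notation S := {mpoly K[n]}.
Hypothesis hI : monomial_ideal I.

Lemma monomial_ideal0 : I 0.
Proof. by case: hI => G IG; apply/IG; exists [::]; rewrite big_nil. Qed.

Lemma monomial_idealD (p q : S) : I p -> I q -> I (p + q).
Proof.
case: hI => G IG /IG[s [sG ->]] /IG[s' [sG' ->]]; apply/IG.
exists (s ++ s'); rewrite big_cat; split=> // v.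
by rewrite mem_cat => /orP[/sG|/sG'].
Qed.

Lemma monomial_idealM (p q : S) : I q -> I (p * q).
Proof.
case: hI => G IG /IG[s [sG ->]]; apply/IG.
exists [seq (p * v.1, v.2) | v <- s]; split; first by move=> v /mapP[w /sG + ->].
by rewrite big_map mulr_sumr; apply: eq_bigr => v _; rewrite mulrA.
Qed.

Lemma msuppM_lem (p q : S) m : m \in msupp (p * q) ->
  exists2 k, k \in msupp q & (k <= m)%MM.
Proof.
by case/msuppM_le/allpairsP => -[m1 m2] /= [_ h ->]; exists m2; rewrite ?lem_addl.
Qed.

Lemma monomial_ideal_msupp (p : S) m : I p -> m \in msupp p -> I 'X_[m].
Proof.
case: hI => G IG /IG[s [sG ->]] /msupp_sum_le/flattenP[_ /mapP[v vs ->]].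
rewrite mem_filter /= in vs; have [k Gk vk] := sG v vs.
rewrite vk => /msuppM_lem[k']; rewrite msuppX inE => /eqP-> km.
rewrite -(submK km) mpolyXD; apply: monomial_idealM; apply/IG.
exists [:: (1, 'X_[k])]; rewrite big_seq1 mul1r; split=> // w.
by rewrite inE => /eqP->; exists k.
Qed.

Lemma monomial_ideal_filter (P : pred 'X_{1..n}) (p : S) : I p -> I (mfilter P p).
Proof.
move=> Ip; rewrite /mfilter big_seq_cond.
apply: (big_ind I) => [||m /andP[mp _]]; first exact: monomial_ideal0.
  exact: monomial_idealD.
by rewrite -mul_mpolyC; apply: monomial_idealM; apply: monomial_ideal_msupp mp.
Qed.

(** Finiteness comes from the finite rank of [F_1]: [I] is generated by the images [g k] of its
    basis and the error [r] of a lift of 1, as [aug] is onto only modulo [I]. The monomials of these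
    polynomials suffice. *)
Lemma finite_monomial_generators (F : graded_free_complex K n) :
  graded_free_resolution I F ->
  exists s : seq 'X_{1..n}, (forall m, m \in s -> I 'X_[m]) /\
    forall m, I 'X_[m] -> exists2 k, k \in s & (k <= m)%MM.
Proof.
move=> hF; have [v Ir] := aug_surj hF 1; set r := 1 - _ in Ir.
pose g k := (row k (diff F 0) *m aug F) 0 0.
have Ig k : I (g k).
  by apply/(aug_exact hF); exists (delta_mx 0 k); rewrite -rowE.
exists (msupp r ++ flatten [seq msupp (g k) | k <- enum 'I_(rk F 1)]); split.
  move=> m; rewrite mem_cat => /orP[|/flattenP[_ /mapP[k _ ->]]].
    exact: monomial_ideal_msupp.
  exact: monomial_ideal_msupp.
move=> m Im; have [w ew] : exists w, 'X_[m] *: v = w *m diff F 0.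
  apply/(aug_exact hF); rewrite -scalemxAl mxE mulrC.
  suff -> : (v *m aug F) 0 0 * 'X_[m] = 'X_[m] - r * 'X_[m].
    by apply: monomial_idealD => //; rewrite -mulNr; apply: monomial_idealM.
  by rewrite /r mulrBl mul1r opprB addrC subrK.
have eX : 'X_[m] = 'X_[m] * r + \sum_k w 0 k * g k.
  have -> : \sum_k w 0 k * g k = ('X_[m] *: v *m aug F) 0 0.
    rewrite ew -mulmxA mxE; apply: eq_bigr => k _.
    by rewrite /g -row_mul [X in _ * X]mxE.
  by rewrite -scalemxAl [X in _ + X]mxE -mulrDr /r subrK mulr1.
have : m \in msupp ('X_[m] : S) by rewrite msuppX inE.
rewrite {1}eX => /msuppD_le; rewrite mem_cat => /orP[/msuppM_lem[k kr km]|].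
  by exists k => //; rewrite mem_cat kr.
case/msupp_sum_le/flattenP => _ /mapP[j _ ->] /msuppM_lem[k kg km].
exists k => //; rewrite mem_cat; apply/orP; right; apply/flattenP.
by exists (msupp (g j)) => //; apply: map_f; rewrite mem_enum.
Qed.

(** Keeps the members of a finite generating list that are minimal within it; [undup] makes the
    indexing injective, as the antichain property demands. *)
Lemma minimal_monomial_generators (F : graded_free_complex K n) :
  graded_free_resolution I F ->
  exists N (u : 'I_N -> 'X_{1..n}),
  [/\ forall x, min_monomial_generator I (u x),
      forall x y, (u x <= u y)%MM -> x = y
    & forall m, I 'X_[m] -> exists x, (u x <= m)%MM].
Proof.
move=> /finite_monomial_generators[s [sI sgen]].
pose minimal m := all (fun k => (k <= m)%MM ==> (k == m)) s.
pose s' := undup (filter minimal s).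
have sP m : I 'X_[m] -> exists2 k, k \in s' & (k <= m)%MM.
  have [d] := ubnP (mdeg m); elim: d m => // d IH m md Im.
  have [k ks km] := sgen m Im; have [kmin|] := boolP (minimal k).
    by exists k; rewrite // mem_undup mem_filter kmin.
  case/allPn => j js; rewrite negb_imply => /andP[jk jnk].
  have [||i is' ij] := IH j; last by exists i => //; apply: lepm_trans (lepm_trans jk km).
    rewrite ltnS in md; apply: leq_trans md; apply: leq_trans (mdeg_lem km).
    by rewrite ltnNge; apply: contra jnk => h; rewrite (lem_mdeg_eq jk h).
  exact: sI.
pose u (x : 'I_(size s')) := nth 0%MM s' x.
have us x : u x \in s' by rewrite mem_nth.
have umin x m : I 'X_[m] -> (m <= u x)%MM -> m = u x.
  move=> /sP[k ks km] mx; have := us x; rewrite mem_undup mem_filter => /andP[/allP xmin _].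
  have kx : k = u x.
    apply/eqP; apply: (implyP (xmin k _)); last exact: lepm_trans mx.
    by move: ks; rewrite mem_undup mem_filter => /andP[].
  by apply: lem_mdeg_eq => //; rewrite -kx mdeg_lem.
have uI x : I 'X_[u x].
  by apply: sI; have := us x; rewrite mem_undup mem_filter => /andP[].
exists (size s'), u; split.
- by move=> x; split=> // m mx Im; apply: umin.
- move=> x y /(umin _ _ (uI x))/eqP; rewrite nth_uniq ?undup_uniq // => /eqP.
  exact: val_inj.
- move=> m /sP[k ks km]; move: (ks); rewrite -index_mem => ki.
  by exists (Ordinal ki); rewrite /u /= nth_index.
Qed.

End MonomialIdeals.

(** * The bound for maximal shifts of an arbitrary graded free resolution *)

Theorem theorem1p1 (K : fieldType) (n e d : nat)
    (he : (2 <= e)%N) (hed : (e <= d)%N)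
    (I : {mpoly K[n]} -> Prop)
    (hI : monomial_ideal I)
    (hgen : forall m, min_monomial_generator I m -> (e <= mdeg m <= d)%N)
    (F : graded_free_complex K n) (hF : graded_free_resolution I F)
    (pd : nat) (hpd : is_pd I pd)
    (a ta : nat) (ha : (2 <= a <= pd)%N)
    (hta : is_max_shift F a ta) (hlt : (ta < e * a)%N)
    (b tab : nat) (hab : (a + b <= pd)%N)
    (htab : is_max_shift F (a + b) tab) :
  (tab <= ta + uphalf ((2 * d - 1) * b))%N.
Proof.
have I0 := monomial_ideal0 hI; have ID := @monomial_idealD _ _ _ hI.
have IM := @monomial_idealM _ _ _ hI; have IF := @monomial_ideal_filter _ _ _ hI.
have [N [u [ugen uanti uI]]] := minimal_monomial_generators hI hF.
have hT : graded_free_resolution I (taylor K u).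
  apply: taylor_resolution => // [x|p m Ip mp]; first by case: (ugen x).
  by apply: uI; apply: monomial_ideal_msupp mp.
(* Nonvanishing of Betti numbers is independent of the resolution, so it can be read off the Taylor
   strands. *)
have betti_tor i t : betti F i.+1 t <> 0%N <-> exists2 m, mdeg m = t & tor K u i.+1 m.
  rewrite (betti_detected_cycle hF) -tor_detected_cycle.
  by split; apply: (detected_cycle_transfer I0 ID IM IF).
case: a ha hta hlt hab htab => [|a] // _ [_ hta] hlt _.
have tor_ta m : tor K u a.+1 m -> (mdeg m <= ta)%N.
  by move=> tm; apply/hta/betti_tor; exists m.
rewrite addSn => -[/betti_tor[m <- tm] _].
have [||||p /tor_ta pta mp] := @tor_bound K n N u e d a.+1 _ _ _ _ b m tm.
- by move=> x; have /hgen/andP[] := ugen x.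
- by move=> x; have /hgen/andP[] := ugen x.
- exact: uanti.
- by move=> q /tor_ta qta; apply: leq_ltn_trans hlt.
(* As (2 d - 1) b = 2 d b - b, its half rounded up is d b minus the half of b rounded down, which is
   the loss allowed by [tor_bound]. *)
have : (d * b <= uphalf ((2 * d - 1) * b) + b./2)%N.
  rewrite mulnBl mul1n -mulnA; lia.
lia.
Qed.
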